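(* Let $G$ be a graph of bounded degree and let $H$ be a bounded Schrödinger operator on $\ell^2(G)$. Then $$\bigcup_{L\in\mathcal{R}(H)}\sigma(L)\subseteq\sigma_{\mathrm{ess}}(H).$$
   Context: All graphs are simple, undirected and connected; a graph $G$ is identified with its vertex set $V(G)$, $u\sim v$ means that $u,v$ are adjacent, and $\mathrm{dist}$ is the graph distance. A Schrödinger operator on a graph $G$ is an operator $H=\Delta+Q$ on $\ell^2(G)=\ell^2(V(G))$ acting by $(H\psi)(v)=\sum_{u\sim v}(\psi(u)-\psi(v))+Q(v)\psi(v)$, where $Q:V(G)\to\mathbb{R}$ is a bounded function. $\sigma(\cdot)$ is the spectrum; $\sigma_{\mathrm{ess}}(\cdot)$ is the essential spectrum (the spectrum minus the isolated eigenvalues of finite multiplicity). $\mathcal{R}$-limits. Put $B_r(v)=\{u\in G:\mathrm{dist}(u,v)\le r\}$ and $N_{v,r}=|B_r(v)|$. For a bijection $\eta:B_r(v)\to\{1,\dots,N_{v,r}\}$ let $\mathcal{I}_\eta:\ell^2(B_r(v))\to\mathbb{C}^{N_{v,r}}$ be the unitary map $\delta_u\mapsto e_{\eta(u)}$, and let $M^{(v)}_{\eta,r}=\mathcal{I}_\eta\, H|_{B_r(v)}\,\mathcal{I}_\eta^{-1}$, where $H|_{B_r(v)}$ is the restriction (compression) of $H$ to $\ell^2(B_r(v))$. A sequence $\{\mathcal{I}_{\eta_r}\}_{r\ge1}$ with bijections $\eta_r:B_r(v)\to\{1,\dots,N_{v,r}\}$ is a coherent sequence at $v$ if $\eta_s(u)=\eta_r(u)$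 for all $r<s$ and $u\in B_r(v)$; in this case write $M^{(v)}_r=M^{(v)}_{\eta_r,r}$. A path to infinity in $G$ is a sequence of vertices $\{v_n\}_{n\ge0}$ with $v_{n+1}\sim v_n$ for all $n$ and $\mathrm{dist}(v_n,v_0)\to\infty$ monotonically as $n\to\infty$. Given a graph $G'$, a vertex $v_0'\in G'$ and a Schrödinger operator $H'$ on $G'$, the triple $\{H',G',v_0'\}$ is an $\mathcal{R}$-limit of $H$ along the path to infinity $\{v_n\}$ if there is a strictly increasing sequence of indices $\{n_j\}_{j\ge1}$ such that (i) for every $j$ there is a coherent sequence of isomorphisms at $v_{n_j}$; (ii) there is a coherent sequence of isomorphisms at $v_0'$ (for $H'$, $G'$); (iii) for every $r\in\mathbb{N}$, $N_{v_{n_j},r}=N_{v_0',r}$ for all sufficiently large $j$, and $\lim_{j\to\infty}M^{(v_{n_j})}_r=M^{(v_0')}_r$ for the matrices defined by these coherent sequences. $\mathcal{R}(H)$ denotes the set of all $\mathcal{R}$-limits of $H$ (along all paths to infinity); an element $L\in\mathcal{R}(H)$ is identified with the operator $H'$ on $\ell^2(G')$. *)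

(* Defs.v *)
From mathcomp Require Import all_boot all_order all_algebra.
From mathcomp Require Import finmap.
From mathcomp Require Import all_classical all_reals all_analysis.
From mathcomp Require Import complex.

Set Implicit Arguments.
Unset Strict Implicit.
Unset Printing Implicit Defensive.

Import Order.TTheory GRing.Theory Num.Theory.
Import numFieldNormedType.Exports.

Local Open Scope classical_set_scope.
Local Open Scope ring_scope.

(* R[i] seen as an abstract numClosedFieldType: R[i] itself carries no
   topology, whereas every numClosedFieldType has the one of its norm. *)
Definition cplx (R : realType) : numClosedFieldType := R[i].

Record graph := Graph {
  vertex :> choiceType;
  adj : rel vertex;
  adj_sym : symmetric adj;
  adj_irr : irreflexive adj;
  adj_conn : forall u v, exists p : seq vertex, path adj u p /\ last u p = v
}.

Definition bounded_degree (G : graph) : Prop :=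
  exists d : nat, forall v : G, ([set u : G | adj u v] #<= `I_d)%card.

Lemma walk_exists (G : graph) (u v : G) : exists n : nat,
  `[< exists p : seq G, [/\ path (@adj G) u p, last u p = v & size p = n] >].
Proof. by have [p [pp lp]] := adj_conn u v; exists (size p); apply/asboolP; exists p. Qed.

Definition dist (G : graph) (u v : G) : nat := ex_minn (walk_exists u v).

Definition gball (G : graph) (v : G) (r : nat) : set G :=
  [set u | (dist u v <= r)%N].

(* This is 0 if the ball is infinite; [coherent] below excludes that case. *)
Definition gball_card (G : graph) (v : G) (r : nat) : nat :=
  #|` fset_set (gball v r)|%fset.

Section Operators.
Variables (R : realType) (V : choiceType).
Local Notation C := (cplx R).
Implicit Types (f g : V -> C) (T : (V -> C) -> (V -> C)) (z : C).

Definition l2normsq f : \bar R :=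
  \esum_(v in [set: V]) ((complex.Re (f v)) ^+ 2 + (complex.Im (f v)) ^+ 2)%:E.

Definition l2 : set (V -> C) := [set f | (l2normsq f < +oo)%E].

Definition l2norm f : R := Num.sqrt (fine (l2normsq f)).

(* An operator on l2(V) is represented by a map on all functions V -> C, of
   which only the values on l2 are relevant. *)
Definition bounded_op T : Prop :=
  [/\ forall f, l2 f -> l2 (T f),
      forall (a : C) f g, l2 f -> l2 g ->
        T (fun v => a * f v + g v) = (fun v => a * T f v + T g v)
    & exists K : R, forall f, l2 f -> l2norm (T f) <= K * l2norm f].

Definition shift_op T z : (V -> C) -> (V -> C) :=
  fun f v => T f v - z * f v.

Definition resolvent_set T : set C :=
  [set z | exists B : (V -> C) -> (V -> C), bounded_op B /\
    forall f, l2 f -> B (shift_op T z f) = f /\ shift_op T z (B f) = f].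

Definition spectrum T : set C := ~` resolvent_set T.

Definition eigenspace T z : set (V -> C) :=
  [set f | l2 f /\ T f = (fun v => z * f v)].

Definition is_eigenvalue T z : Prop :=
  exists f, eigenspace T z f /\ f <> (fun=> 0).

Definition finite_multiplicity T z : Prop :=
  exists (n : nat) (e : 'I_n -> V -> C),
    eigenspace T z =
    [set f | exists c : 'I_n -> C, f = (fun v => \sum_(i < n) c i * e i v)].

Definition ess_spectrum T : set C :=
  spectrum T `\` [set z | [/\ isolated (spectrum T) z,
                              is_eigenvalue T z & finite_multiplicity T z]].

Definition delta (u : V) : V -> C := fun w => (w == u)%:R.

End Operators.

Record schrodinger (R : realType) (G : graph) := Schrodinger {
  potential : G -> R;
  potential_bounded : exists K : R, forall v, `|potential v| <= K
}.

(* \sum_(u \in A) is the sum of a finitely supported family; it is the intended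
   sum over neighbours at every vertex of finite degree. *)
Definition schrodinger_op (R : realType) (G : graph) (H : schrodinger R G)
    (psi : G -> cplx R) (v : G) : cplx R :=
  (\sum_(u \in [set u : G | adj u v]) (psi u - psi v))
  + (potential H v)%:C%C * psi v.

Section RLimits.
Variable R : realType.
Local Notation C := (cplx R).

(* The matrix of the compression of T to l2(B_r(v)) in the orthonormal basis
   (delta_u), u in B_r(v), ordered by the bijection eta from B_r(v) onto
   {0, ..., N - 1}; <delta_u, T delta_w> is (T delta_w)(u). *)
Definition ball_matrix (G : graph) (T : (G -> C) -> (G -> C)) (v : G) (r : nat)
    (eta : G -> nat) : 'M[C]_(gball_card v r) :=
  let lab : nat -> G := 'pinv_(fun=> v) (gball v r) eta in
  \matrix_(a, b) T (delta R (lab b)) (lab a).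

(* Labels start at 0 rather than at 1; radii r >= 1. *)
Definition coherent (G : graph) (v : G) (eta : nat -> G -> nat) : Prop :=
  (forall r, (0 < r)%N ->
     set_bij (gball v r) `I_(gball_card v r) (eta r)) /\
  (forall r s, (0 < r)%N -> (r < s)%N ->
     forall u, gball v r u -> eta s u = eta r u).

Definition path_to_infinity (G : graph) (v : nat -> G) : Prop :=
  [/\ forall n, adj (v n.+1) (v n),
      {homo (fun n => dist (v n) (v 0%N)) : m n / (m <= n)%N}
    & (fun n => dist (v n) (v 0%N)) @ \oo --> \oo].

(* The matrices along the sequence only have the dimension of the limit from
   some rank on, whence conform_mx, which is the identity once they do. *)
Definition R_limit_along (G : graph) (H : schrodinger R G) (v : nat -> G)
    (G' : graph) (H' : schrodinger R G') (v0' : G') : Prop :=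
  exists n : nat -> nat, {homo n : i j / (i < j)%N} /\
  exists (eta : nat -> nat -> G -> nat) (eta' : nat -> G' -> nat),
  [/\ forall j, coherent (v (n j)) (eta j),
      coherent v0' eta'
    & forall r, (0 < r)%N ->
        (\forall j \near \oo, gball_card (v (n j)) r = gball_card v0' r) /\
        (fun j => conform_mx (0 : 'M[C]_(gball_card v0' r))
           (ball_matrix (schrodinger_op H) (v (n j)) r (eta j r))) @ \oo
        --> ball_matrix (schrodinger_op H') v0' r (eta' r)].

Definition R_limit (G : graph) (H : schrodinger R G)
    (G' : graph) (H' : schrodinger R G') (v0' : G') : Prop :=
  exists v : nat -> G, path_to_infinity v /\ R_limit_along H v H' v0'.

End RLimits.

(* Main.v *)
(* Idea. In terms of real finitely supported functions, a real [x] lies in the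
   spectrum of a Schroedinger operator [T] if and only if [T - x] is not bounded below,
   and nonreal numbers are never in the spectrum: the operator [(T - x)^2 + y^2] is
   inverted by a Neumann series that converges pointwise because [T] is local.  If [x]
   is in the spectrum of an R-limit, an approximate eigenvector with finite support can
   be copied to balls around infinitely many points of the path, hence outside of any
   finite set.  This gives approximate eigenvectors of [H] with disjoint supports.
   They exclude a resolvent at [x]; and if [x] were isolated, the form [(T - x)^2]
   would have a gap off the kernel, so that these vectors would be close to linearly
   independent elements of the eigenspace, which would have infinite dimension. *)
From HB Require Import structures.
Require Import Defs.
From mathcomp Require Import all_boot all_order all_algebra.
From mathcomp Require Import finmap.
From mathcomp Require Import all_classical all_reals all_analysis.
From mathcomp Require Import complex.
From mathcomp Require Import ring lra.

Set Implicit Arguments.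
Unset Strict Implicit.
Unset Printing Implicit Defensive.

Import Order.TTheory GRing.Theory Num.Theory.
Import numFieldNormedType.Exports.

Local Open Scope classical_set_scope.
Local Open Scope ring_scope.

(** * Symmetric forms *)

(** The proof works with quadratic inequalities on finitely supported real functions. [T] has real
    coefficients, so it acts separately on real and imaginary parts; and a local operator reads
    finitely many values at each vertex, so an inequality proved for finite supports passes to all
    square-summable functions with the same constant. The delicate step is the gap. Isolation of [x]
    only says that each [l != x] near [x] has some lower bound for [T - l], with an uncontrolled
    constant. An extremal argument turns these into the sharp bound [|S f - d f| >= |d| |f|] for
    [S = T - x] and [d = r / 2] or [d = - r / 2], that is [S^2 - r S >= 0] and [S^2 + r S >= 0]. The
    kernel of [S] may contain no nonzero finitely supported function, so the gap is stated on the
    range of [S^2] rather than on the orthogonal complement of the kernel, as [r^2 S^4 <= S^6]. The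
    limit graph comes with no degree bound; the bound on its operator is inherited from [H] in the
    limit. *)

Lemma sqr_sum_le (R : realType) (I : Type) (r : seq I) (a : I -> R) :
  (\sum_(i <- r) a i) ^+ 2 <= (size r)%:R * \sum_(i <- r) a i ^+ 2.
Proof.
elim: r => [|i r IH]; first by rewrite !big_nil expr0n mul0r.
rewrite !big_cons /= mulrS.
have t0 : 0 <= \sum_(j <- r) a j ^+ 2 by apply: sumr_ge0 => j _; exact: sqr_ge0.
move: (\sum_(j <- r) _) (\sum_(j <- r) _) (a i) t0 IH => s t x t0 st.
have s2 : 2 * x * s <= (size r)%:R * x ^+ 2 + t.
  case: (size r) st => [|n] st.
    have -> : s = 0 by apply/eqP; rewrite -sqrf_eq0 eq_le sqr_ge0 andbT -(mul0r t).
    by rewrite mulr0 mul0r add0r.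
  have n0 : (0 : R) < n.+1%:R by rewrite ltr0n.
  have : 0 <= (n.+1%:R * x - s) ^+ 2 / n.+1%:R by rewrite divr_ge0 ?sqr_ge0 // ltW.
  have -> : (n.+1%:R * x - s) ^+ 2 / n.+1%:R
    = n.+1%:R * x ^+ 2 - 2 * x * s + s ^+ 2 / n.+1%:R.
    by field; rewrite gt_eqF.
  have : s ^+ 2 / n.+1%:R <= t by rewrite ler_pdivrMr // mulrC.
  by set u := s ^+ 2 / _; set N : R := n.+1%:R; clearbody u; clearbody N; lra.
by move: st s2; lra.
Qed.

Lemma linear_shift (R : comPzRingType) (E : lmodType R) (S : {linear E -> E})
  (d : R) : exists U : {linear E -> E}, forall f, U f = S f - d *: f.
Proof.
have Ul : linear (fun f => S f - d *: f).
  move=> a x y; rewrite linearP scalerBr scalerDr !scalerA (mulrC d a).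
  by rewrite opprD addrACA.
pose HU := GRing.isLinear.Build _ _ _ _ (fun f => S f - d *: f) Ul.
by exists (HB.pack_for {linear E -> E} (fun f => S f - d *: f) HU).
Qed.

Section SymmetricForms.
Variables (R : realType) (E : lmodType R) (ip : E -> E -> R).
Hypothesis ipC : forall f g, ip f g = ip g f.
Hypothesis ip_linl : forall a f g h, ip (a *: f + g) h = a * ip f h + ip g h.
Hypothesis ip_ge0 : forall f, 0 <= ip f f.
Implicit Types f g h : E.

Lemma ip0l h : ip 0 h = 0.
Proof. by have := ip_linl 1 0 0 h; rewrite scaler0 addr0 mul1r; lra. Qed.

Lemma ipDl f g h : ip (f + g) h = ip f h + ip g h.
Proof. by rewrite -[f in LHS]scale1r ip_linl mul1r. Qed.

Lemma ipZl a f h : ip (a *: f) h = a * ip f h.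
Proof. by rewrite -[a *: f]addr0 ip_linl ip0l addr0. Qed.

Lemma ipNl f h : ip (- f) h = - ip f h.
Proof. by rewrite -scaleN1r ipZl mulN1r. Qed.

Lemma ipDr f g h : ip h (f + g) = ip h f + ip h g.
Proof. by rewrite !(ipC h) ipDl. Qed.

Lemma ipZr a f h : ip h (a *: f) = a * ip h f.
Proof. by rewrite !(ipC h) ipZl. Qed.

Lemma ipNr f h : ip h (- f) = - ip h f.
Proof. by rewrite !(ipC h) ipNl. Qed.

Definition ipE := (ipDl, ipNl, ipZl, ipDr, ipNr, ipZr).

Definition ip_sym (P : E -> E) := forall f g, ip (P f) g = ip f (P g).

(** Nonnegativity of [P], tested on [f - K^-1 *: P f], gives [P^2 <= K P]; the cubic term is
    absorbed by the upper bound at [P f]. *)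
Lemma psd_norm (P : {linear E -> E}) (K : R) : 0 < K -> ip_sym P ->
  (forall f, 0 <= ip (P f) f) -> (forall f, ip (P f) f <= K * ip f f) ->
  forall f, ip (P f) (P f) <= K * ip (P f) f.
Proof.
move=> K0 Psym P0 PK f.
have := P0 (f - K^-1 *: P f).
rewrite linearB linearZ /= !ipE (Psym (P f) f).
have : K^-1 * ip (P (P f)) (P f) <= ip (P f) (P f).
  by rewrite mulrC ler_pdivrMr // mulrC; exact: PK.
rewrite (Psym (P f)) => h1 h2.
rewrite mulrC -ler_pdivrMr // mulrC.
have Ki : 0 < K^-1 by rewrite invr_gt0.
move: h1 h2; set a := ip (P f) (P f); set b := ip (P f) (P (P f)).
set k := K^-1 in Ki *; set c := ip (P f) f => h1 h2.
have := ler_wpM2l (ltW Ki) h1; nra.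
Qed.

(** The term [K^-1 * ip (P f) f] is kept on the left: coercivity or a gap later bounds it below by a
    multiple of [ip f f], which makes the contraction strict. *)
Lemma psd_contraction (P : {linear E -> E}) (K : R) : 0 < K ->
  (forall f, ip (P f) (P f) <= K * ip (P f) f) ->
  forall f, ip (f - K^-1 *: P f) (f - K^-1 *: P f) + K^-1 * ip (P f) f <= ip f f.
Proof.
move=> K0 PK f; rewrite !ipE (ipC f (P f)).
have Ki : 0 < K^-1 by rewrite invr_gt0.
have : K^-1 * ip (P f) (P f) <= ip (P f) f.
  by rewrite mulrC ler_pdivrMr // mulrC.
set k := K^-1 in Ki *; set a := ip _ (P f); set c := ip _ _ => h1.
have := ler_wpM2l (ltW Ki) h1; nra.
Qed.

(* If the optimal constant [m ^+ 2] were smaller than [r ^+ 2], then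
   [D := (S - d)^2 - m^2 = (S - (d + m)) (S - (d - m))] would be a nonnegative
   form, bounded below in norm, hence coercive by [psd_norm]. *)
Lemma lower_bound_dist (S : {linear E -> E}) (K d r : R) : 0 < K -> ip_sym S ->
  (forall f, ip (S f) (S f) <= K * ip f f) ->
  (forall l, `|l - d| < r -> exists2 c, 0 < c &
     forall f, c * ip f f <= ip (S f - l *: f) (S f - l *: f)) ->
  0 <= r ->
  forall f, r ^+ 2 * ip f f <= ip (S f - d *: f) (S f - d *: f).
Proof.
move=> K0 Ssym SK Slb r0.
pose A := [set c : R | 0 <= c /\
  forall f, c ^+ 2 * ip f f <= ip (S f - d *: f) (S f - d *: f)].
suff Ar : A r by case: Ar.
have A0 : A 0.
  by split => // f; rewrite expr0n mul0r.
(* [A] is unbounded exactly when [ip f f = 0] for all [f]; an element of [A] above [r] then gives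
   the bound. *)
have [Ab|nAb] := pselect (has_ubound A); last first.
  split=> // f.
  have [c [c0 cA]] : exists c, A c /\ r < c.
    apply: contrapT => h; apply: nAb; exists r => c cA.
    by rewrite leNgt; apply/negP => rc; apply: h; exists c.
  case: c0 => c0 /(_ f); apply: le_trans; apply: ler_wpM2r => //.
  by rewrite ler_sqr ?nnegrE // ltW.
set m := sup A.
have Asup : has_sup A by split => //; exists 0.
have m0 : 0 <= m by apply: sup_upper_bound.
have Am : A m.
  split=> // f.
  have [f0|f0] := eqVneq (ip f f) 0; first by rewrite f0 mulr0 ip_ge0.
  have fp : 0 < ip f f by rewrite lt_def f0 ip_ge0.
  rewrite -ler_pdivlMr // -[leRHS]sqr_sqrtr; last by rewrite divr_ge0 // ip_ge0.
  rewrite ler_sqr ?nnegrE // ?sqrtr_ge0 //.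
  apply: ge_sup; first by exists 0.
  move=> c [c0 /(_ f)]; rewrite -ler_pdivlMr // => h.
  rewrite -(ler_sqr (R:=R)) ?nnegrE // ?sqrtr_ge0 // sqr_sqrtr //.
  by rewrite divr_ge0 // ip_ge0.
have [rm|mr] := leP r m.
  split => // f; apply: le_trans (Am.2 f); apply: ler_wpM2r => //.
  by rewrite ler_sqr ?nnegrE.
exfalso.
have [|c1 c10 h1] := Slb (d + m).
  by rewrite addrAC subrr add0r ger0_norm.
have [|c2 c20 h2] := Slb (d - m).
  by rewrite addrAC subrr add0r normrN ger0_norm.
have [U UE] := linear_shift S d.
have Usym : ip_sym U by move=> x y; rewrite !UE !ipE Ssym.
have [D DUE] := linear_shift (U \o U) (m ^+ 2).
have Dsym : ip_sym D by move=> x y; rewrite !DUE /= !ipE !Usym.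
have DE f : ip (D f) f = ip (S f - d *: f) (S f - d *: f) - m ^+ 2 * ip f f.
  by rewrite -UE DUE /= !ipE Usym.
have D0 f : 0 <= ip (D f) f by rewrite DE subr_ge0; exact: Am.2.
(* From [|a - b|^2 <= 2 |a|^2 + 2 |b|^2], applied to [S f - d *: f]. *)
pose L := 2 * K + 2 * d ^+ 2.
have L0 : 0 < L by rewrite /L; have := sqr_ge0 d; lra.
have DL f : ip (D f) f <= L * ip f f.
  rewrite DE; apply: (@le_trans _ _ (ip (S f - d *: f) (S f - d *: f))).
    by rewrite lerBlDr lerDl mulr_ge0 // sqr_ge0.
  rewrite /L mulrDl; have := SK f.
  have := ip_ge0 (S f + d *: f).
  by rewrite !ipE (ipC f (S f)); nra.
have DnL f := @psd_norm D L L0 Dsym D0 DL f.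
have Dc f : c1 * c2 * ip f f <= ip (D f) (D f).
  have -> : D f = S (S f - (d - m) *: f) - (d + m) *: (S f - (d - m) *: f).
    have Up g : S g - (d + m) *: g = U g - m *: g.
      by rewrite UE scalerDl opprD addrA.
    have Um : S f - (d - m) *: f = U f + m *: f.
      by rewrite UE scalerBl opprB addrA addrAC.
    rewrite Um Up DUE linearD /=.
    by rewrite [U (m *: f)]linearZ scalerDr scalerA opprD !addrA addrK expr2.
  apply: le_trans (h1 _); rewrite -mulrA; apply: ler_wpM2l (h2 f).
  exact: ltW.
(* [c1 * c2 * ip f f <= ip (D f) (D f) <= L * ip (D f) f], so [m ^+ 2] can be increased by [e]. *)
pose e := c1 * c2 / L.
have e0 : 0 < e by rewrite !mulr_gt0 // invr_gt0.
have Ae : A (Num.sqrt (m ^+ 2 + e)).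
  split=> [|f]; first exact: sqrtr_ge0.
  rewrite sqr_sqrtr; last by rewrite addr_ge0 ?sqr_ge0 // ltW.
  rewrite mulrDl -lerBrDl -DE /e mulrAC ler_pdivrMr // mulrC [leRHS]mulrC.
  apply: le_trans (DnL f); rewrite mulrC; exact: Dc.
have := sup_upper_bound Asup Ae; rewrite -/m leNgt => /negP; apply.
rewrite -[ltLHS](ger0_norm m0) -sqrtr_sqr ltr_sqrt ?ltrDl //.
by rewrite ltr_wpDl ?sqr_ge0.
Qed.

(* [(S^2 - r S) (S^2 + r S) 2 S^2 >= 0], the left side being [A B A + B A B] for
   the commuting nonnegative forms [A, B := S^2 -+ r S]. *)
Lemma spectral_gap (S : {linear E -> E}) (r : R) : ip_sym S ->
  (forall f, r * ip (S f) f <= ip (S f) (S f)) ->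
  (forall f, - r * ip (S f) f <= ip (S f) (S f)) ->
  forall f, r ^+ 2 * ip (S (S f)) (S (S f)) <= ip (S (S (S f))) (S (S (S f))).
Proof.
move=> Ssym h1 h2 f.
(* The test vectors are [A f] and [B f]: [B >= 0] is used at [A f], and [A >= 0] at [B f]. *)
have := h2 (S (S f) - r *: S f); have := h1 (S (S f) + r *: S f).
rewrite !linearB !linearD !linearZ /= !ipE.
rewrite !(ipC (S (S f)) (S (S (S f)))).
have -> : ip (S (S (S f))) (S f) = ip (S (S f)) (S (S f)) by rewrite Ssym.
nra.
Qed.

End SymmetricForms.

(** * Finitely supported functions and local operators *)

Lemma linear_relax (R : comPzRingType) (E : lmodType R) (P : {linear E -> E})
  (k : R) : exists L : {linear E -> E}, forall f, L f = f - k *: P f.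
Proof.
have Ll : linear (fun f => f - k *: P f).
  move=> a x y; rewrite linearP scalerBr scalerDr !scalerA (mulrC k a).
  by rewrite opprD addrACA.
pose HL := GRing.isLinear.Build _ _ _ _ (fun f => f - k *: P f) Ll.
by exists (HB.pack_for {linear E -> E} (fun f => f - k *: P f) HL).
Qed.

Lemma cvg_sumr (R : realType) (I : eqType) (r : seq I) (F : I -> nat -> R)
  (l : I -> R) : (forall i, i \in r -> F i @ \oo --> l i) ->
  (fun n => \sum_(i <- r) F i n) @ \oo --> \sum_(i <- r) l i.
Proof.
elim: r => [|i r IH] Fl.
  by under eq_fun do rewrite big_nil; rewrite big_nil; exact: cvg_cst.
under eq_fun do rewrite big_cons; rewrite big_cons.
apply: (@cvgD _ R^o); first by apply: Fl; rewrite mem_head.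
by apply: IH => k kr; apply: Fl; rewrite in_cons kr orbT.
Qed.

Section FiniteSupport.
Variables (R : realType) (V : choiceType).
Local Notation fct := (V -> R^o).
Implicit Types (f g : fct) (X Y : {fset V}) (v : V).

Lemma fctZDE (a : R) f g v : (a *: f + g) v = a * (f v : R) + (g v : R) :> R.
Proof. by []. Qed.

Definition supported f X := forall v, v \notin X -> f v = 0.

Definition fsupp_pred : {pred fct} := fun f => `[< exists X, supported f X >].

Lemma fsupp_submod_closed : submod_closed fsupp_pred.
Proof.
split=> [|a f g].
  by apply/asboolP; exists fset0 => v _.
move=> /asboolP[X fX] /asboolP[Y gY]; apply/asboolP; exists (X `|` Y)%fset => v.
rewrite inE negb_or => /andP[vX vY].
by rewrite fctE /= [in X in X + _]fctE fX // gY // scaler0 addr0.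
Qed.

HB.instance Definition _ := GRing.isSubmodClosed.Build R fct fsupp_pred
  fsupp_submod_closed.

(** A module of its own, so that the results on symmetric forms apply with [E := fsfct]. *)
Record fsfct := FsFct { fsval :> fct; _ : fsval \in fsupp_pred }.
HB.instance Definition _ := [isSub for fsval].
HB.instance Definition _ := [Choice of fsfct by <:].
HB.instance Definition _ := [SubChoice_isSubLmodule of fsfct by <:].

Lemma fsfct_supp (e : fsfct) : exists X, supported e X.
Proof. by have := valP e => /asboolP. Qed.

Definition mk_fsfct f X (fX : supported f X) : fsfct :=
  FsFct (introT (asboolP _) (ex_intro _ X fX)).

Definition fsip (e h : fsfct) : R := \sum_(v \in [set: V]) (e v : R) * (h v : R).

Lemma fsip_fset (e h : fsfct) X : supported e X ->
  fsip e h = \sum_(v <- X) (e v : R) * (h v : R).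
Proof. by move=> eX; apply: fsbigTE => v /eX ->; rewrite mul0r. Qed.

Lemma fsipC e h : fsip e h = fsip h e.
Proof. by apply: eq_fsbigr => v _; rewrite mulrC. Qed.

Lemma fsip_linl a (e h k : fsfct) : fsip (a *: e + h) k = a * fsip e k + fsip h k.
Proof.
have [X kX] := fsfct_supp k; rewrite !(fsipC _ k) !(fsip_fset _ kX) mulr_sumr.
rewrite -big_split; apply: eq_bigr => v _ /=.
rewrite fctZDE; ring.
Qed.

Lemma fsip_ge0 e : 0 <= fsip e e.
Proof.
have [X eX] := fsfct_supp e; rewrite (fsip_fset _ eX).
by apply: sumr_ge0 => v _; rewrite -expr2 sqr_ge0.
Qed.

Definition sqsum X f : R := \sum_(v <- X) (f v : R) ^+ 2.

(** Bounds the squared l2 norm through finite partial sums alone, which makes it stable under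
    pointwise limits. *)
Definition sq_bounded f (M : R) := forall X, sqsum X f <= M.

Lemma sqsum_ge0 X f : 0 <= sqsum X f.
Proof. by apply: sumr_ge0 => v _; rewrite sqr_ge0. Qed.

Lemma fsip_sqsum (e : fsfct) X : supported e X -> fsip e e = sqsum X e.
Proof. by move=> eX; rewrite (fsip_fset _ eX); apply: eq_bigr => v _. Qed.

Lemma sqsum_sub X Y f : (X `<=` Y)%fset -> sqsum X f <= sqsum Y f.
Proof.
move=> XY; rewrite /sqsum (big_fsetID _ (mem X) Y) /= -[leLHS]addr0.
apply: lerD; last by apply: sumr_ge0 => v _; rewrite sqr_ge0.
have -> : [fset x | x in Y & mem X x]%fset = X.
  apply/fsetP => v; rewrite !inE /= andbC.
  by case: (boolP (v \in X)) => //= /(fsubsetP XY) ->.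
exact: lexx.
Qed.

Lemma sq_bounded_fsip (e : fsfct) : sq_bounded e (fsip e e).
Proof.
move=> X; have [Y eY] := fsfct_supp e.
have eXY : supported e (X `|` Y)%fset.
  by move=> v; rewrite inE negb_or => /andP[_ /eY].
by rewrite (fsip_sqsum eXY); apply: sqsum_sub; exact: fsubsetUl.
Qed.

Lemma sq_bounded_le f (M N : R) : M <= N -> sq_bounded f M -> sq_bounded f N.
Proof. by move=> MN fM X; apply: le_trans MN. Qed.

Lemma sq_bounded_val f (M : R) v : sq_bounded f M -> (f v : R) ^+ 2 <= M.
Proof. by move/(_ [fset v]%fset); rewrite /sqsum big_seq_fset1. Qed.

(** The triangle inequality from a weighted pointwise one: the weights [b / a] and [a / b] are those
    for which the right side adds up to exactly [(a + b) ^+ 2]. *)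
Lemma sq_boundedD f g (a b : R) : 0 < a -> 0 < b ->
  sq_bounded f (a ^+ 2) -> sq_bounded g (b ^+ 2) ->
  sq_bounded (f + g) ((a + b) ^+ 2).
Proof.
move=> a0 b0 fa gb X.
have le (x y : R) : (x + y) ^+ 2 <= (1 + b / a) * x ^+ 2 + (1 + a / b) * y ^+ 2.
  rewrite -subr_ge0.
  have -> : (1 + b / a) * x ^+ 2 + (1 + a / b) * y ^+ 2 - (x + y) ^+ 2
     = (b * x - a * y) ^+ 2 / (a * b).
    by field; rewrite !gt_eqF.
  by rewrite divr_ge0 ?sqr_ge0 // mulr_ge0 // ltW.
apply: (@le_trans _ _ ((1 + b / a) * sqsum X f + (1 + a / b) * sqsum X g)).
  by rewrite !mulr_sumr -big_split; apply: ler_sum => v _; exact: le.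
have -> : (a + b) ^+ 2 = (1 + b / a) * a ^+ 2 + (1 + a / b) * b ^+ 2.
  by field; rewrite !gt_eqF.
by apply: lerD; apply: ler_wpM2l => //; rewrite addr_ge0 // divr_ge0 // ltW.
Qed.

Definition truncate f X : fct := fun v => if v \in X then f v else 0.

Lemma truncate_supported f X : supported (truncate f X) X.
Proof. by move=> v /negbTE vX; rewrite /truncate vX. Qed.

(** Locality plays the role of continuity: such maps act on arbitrary functions and, when linear,
    commute with pointwise limits. *)
Definition local (L : fct -> fct) := forall v, exists X, forall f g,
  {in X, f =1 g} -> L f v = L g v.

Lemma local_id : local id.
Proof. by move=> v; exists [fset v]%fset => f g; apply; rewrite inE. Qed.

Lemma local_fset (L : fct -> fct) X : local L -> exists Y, forall v f g,
  v \in X -> {in Y, f =1 g} -> L f v = L g v.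
Proof.
move=> /choice[nb nbL]; exists (\bigcup_(v <- X) nb v)%fset => v f g vX fg.
apply: nbL => u uv; apply: fg; apply/bigfcupP; exists v => //.
by rewrite vX.
Qed.

Lemma local_comp (L1 L2 : fct -> fct) : local L1 -> local L2 -> local (L1 \o L2).
Proof.
move=> l1 l2 v; have [X h1] := l1 v; have [Y h2] := local_fset X l2.
by exists Y => f g fg; apply: h1 => u uX; apply: h2 fg.
Qed.

Lemma local_comb (a b : R) (L1 L2 : fct -> fct) : local L1 -> local L2 ->
  local (fun f => a *: L1 f + b *: L2 f).
Proof.
move=> l1 l2 v; have [X h1] := l1 v; have [Y h2] := l2 v.
exists (X `|` Y)%fset => f g fg.
rewrite !fctE /=; congr (_ *: _ + _ *: _).
  by apply: h1 => u uX; apply: fg; rewrite inE uX.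
by apply: h2 => u uY; apply: fg; rewrite inE uY orbT.
Qed.

(* Only the values of [f] on a finite set matter, so [f] may be replaced there
   by a finitely supported function of smaller norm. *)
Lemma local_bound_extend (L1 L2 : fct -> fct) (t q : R) :
  local L1 -> local L2 -> 0 <= q ->
  (forall (e : fsfct) X, sqsum X (L1 e) + t * sqsum X (L2 e) <= q * fsip e e) ->
  forall f M X, sq_bounded f M -> sqsum X (L1 f) + t * sqsum X (L2 f) <= q * M.
Proof.
move=> l1 l2 q0 h f M X fM.
have [Y1 h1] := local_fset X l1; have [Y2 h2] := local_fset X l2.
pose Y := (Y1 `|` Y2)%fset.
have eqY : {in Y, f =1 truncate f Y} by move=> v vY; rewrite /truncate vY.
pose e := mk_fsfct (@truncate_supported f Y).
have -> : sqsum X (L1 f) = sqsum X (L1 e).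
  rewrite /sqsum big_seq [RHS]big_seq; apply: eq_bigr => v vX; congr (_ ^+ 2).
  by apply: h1 => // u uY; apply: eqY; rewrite inE uY.
have -> : sqsum X (L2 f) = sqsum X (L2 e).
  rewrite /sqsum big_seq [RHS]big_seq; apply: eq_bigr => v vX; congr (_ ^+ 2).
  by apply: h2 => // u uY; apply: eqY; rewrite inE uY orbT.
apply: le_trans (h e X) _; apply: ler_wpM2l => //.
rewrite (@fsip_sqsum e Y (@truncate_supported f Y)).
apply: le_trans (fM Y); rewrite /sqsum big_seq [leRHS]big_seq.
by apply: ler_sum => v /eqY ->.
Qed.

Definition basisf u : fct := fun v => (v == u)%:R.

Lemma local_expand (L : {linear fct -> fct}) v : local L -> exists X, forall f,
  L f v = \sum_(u <- X) f u * L (basisf u) v.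
Proof.
move=> /(_ v)[X h]; exists X => f.
have -> : L f v = L (\sum_(u <- X) f u *: basisf u) v.
  apply: h => u uX; rewrite fct_sumE (big_fsetD1 u) //= big_seq big1 => [|w].
    by rewrite addr0 fctE /basisf /= eqxx scaler1.
  rewrite !inE => /andP[wu _].
  by rewrite fctE /basisf /= eq_sym (negbTE wu) scaler0.
rewrite linear_sum fct_sumE; apply: eq_bigr => u _.
by rewrite linearZ.
Qed.

Lemma local_cvg (L : {linear fct -> fct}) (F : nat -> fct) f : local L ->
  (forall v, (fun n => F n v : R) @ \oo --> (f v : R)) ->
  forall v, (fun n => L (F n) v : R) @ \oo --> (L f v : R).
Proof.
move=> l Ff v; have [X h] := local_expand v l.
rewrite h; under eq_fun do rewrite h.
apply: cvg_sumr => u _; apply: (@cvgM R) => //; exact: cvg_cst.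
Qed.

Lemma sq_bounded_cvg (F : nat -> fct) f (M : R) :
  (forall v, (fun n => F n v : R) @ \oo --> (f v : R)) ->
  (forall n, sq_bounded (F n) M) -> sq_bounded f M.
Proof.
move=> Ff FM X.
have cv : (fun n => sqsum X (F n)) @ \oo --> sqsum X f.
  by apply: cvg_sumr => u _; rewrite expr2; under eq_fun do rewrite expr2; apply: cvgM.
by apply: (cvgr_to_le cv); apply: nearW => n; exact: FM.
Qed.

(** The series of the [iter n L f] converges absolutely at each vertex by the geometric bound.
    Locality lets [L] pass to the limit, and the uniform bound on the partial sums survives it. *)
Lemma neumann_series (L : {linear fct -> fct}) (f : fct) (q M : R) :
  local L -> 0 < q < 1 -> 0 < M ->
  (forall n, sq_bounded (iter n L f) ((q ^+ n * M) ^+ 2)) ->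
  exists g, sq_bounded g ((M / (1 - q)) ^+ 2) /\ g - L g = f.
Proof.
move=> l /andP[q0 q1] M0 bd.
have q1' : 0 < 1 - q by rewrite subr_gt0.
pose a n v : R := iter n L f v.
have an n v : `|a n v| <= geometric M q n.
  have := sq_bounded_val v (bd n).
  rewrite -/(a n v) -ler_sqrt ?sqr_ge0 // !sqrtr_sqr [X in _ <= X -> _]ger0_norm.
    by rewrite /geometric /= mulrC.
  by rewrite mulr_ge0 ?exprn_ge0 // ltW.
have cva v : cvgn (series (a ^~ v)).
  apply: (@normed_cvg R R^o); apply: (@series_le_cvg _ _ (geometric M q)) => //.
  - by move=> n; exact: normr_ge0.
  - by move=> n; rewrite /geometric /= mulr_ge0 ?exprn_ge0 // ltW.
  - by move=> n; exact: an.
  - by apply: is_cvg_geometric_series; rewrite ger0_norm // ltW.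
pose S n : fct := \sum_(k < n) iter k L f.
have SE n v : (S n v : R) = series (a ^~ v) n.
  by rewrite /S fct_sumE seriesEord.
pose g : fct := fun v => lim (series (a ^~ v) @ \oo).
have Sg v : (fun n => S n v : R) @ \oo --> (g v : R).
  by under eq_fun do rewrite SE; exact: cva.
have SL n : S n - L (S n) = f - iter n L f.
  elim: n => [|n IH]; first by rewrite /S big_ord0 linear0 !subrr.
  have -> : S n.+1 = S n + iter n L f by rewrite /S big_ord_recr.
  by rewrite linearD /= opprD addrACA IH addrA subrK.
exists g; split.
  (* The partial sums start at [S 1] because [sq_boundedD] asks for positive radii and [S 0] would
     have radius 0. *)
  have Sb n : sq_bounded (S n.+1) ((M * (1 - q ^+ n.+1) / (1 - q)) ^+ 2).
    elim: n => [|n IH].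
      rewrite /S big_ord1 /= expr1 mulfK ?gt_eqF //.
      by have := bd 0%N; rewrite expr0 mul1r.
    have -> : S n.+2 = S n.+1 + iter n.+1 L f by rewrite /S big_ord_recr.
    have -> : M * (1 - q ^+ n.+2) / (1 - q)
      = M * (1 - q ^+ n.+1) / (1 - q) + q ^+ n.+1 * M.
      by rewrite exprS; field; rewrite gt_eqF.
    apply: sq_boundedD => //; last by rewrite mulr_gt0 ?exprn_gt0.
    by rewrite !mulr_gt0 ?invr_gt0 // subr_gt0 exprn_ilt1 // ltW.
  apply: (@sq_bounded_cvg (fun n => S n.+1)).
    move=> v; have := Sg v; rewrite -(cvg_shiftS (fun n => S n v : R)).
    exact.
  move=> n; apply: sq_bounded_le (Sb n).
  have qn1 : q ^+ n.+1 <= 1 by rewrite exprn_ile1 // ltW.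
  have qn0 : 0 <= q ^+ n.+1 by rewrite exprn_ge0 // ltW.
  rewrite ler_sqr ?nnegrE ?divr_ge0 ?mulr_ge0 ?subr_ge0 // ?ltW //.
  by rewrite ltr_pM2r ?invr_gt0 // gtr_pMr // gtrBl exprn_gt0.
apply/funext => v.
have c1 : (fun n => (f - iter n L f) v : R) @ \oo --> ((g - L g) v : R).
  under eq_fun do rewrite -SL.
  by apply: (@cvgB _ R^o) => //; exact: (local_cvg l Sg).
have c2 : (fun n => (f - iter n L f) v : R) @ \oo --> (f v : R).
  have a0 : a ^~ v @ \oo --> (0 : R) by exact: cvg_series_cvg_0 (cva v).
  rewrite -[X in _ --> X]subr0; apply: (@cvgB _ R^o) => //; exact: cvg_cst.
exact: (cvg_unique _ c1 c2).
Qed.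

End FiniteSupport.

(** * Inversion and distance to the kernel *)

Section LocalOperators.
Variables (R : realType) (V : choiceType).
Local Notation fct := (V -> R^o).
Local Notation fs := (fsfct R V).
Local Notation ip := (@fsip R V).
Implicit Types (f g : fct) (X Y : {fset V}) (v : V) (e : fs).

(** Couples the operator on all functions, where solutions are found, with its restriction to finite
    supports, where the form is defined and estimates are proved. *)
Definition restricts (T : fct -> fct) (TF : fs -> fs) :=
  local T /\ forall e, TF e = T e :> fct.

Lemma restricts_relax (P L : fct -> fct) (PF LF : fs -> fs) (k : R) :
  restricts P PF -> (forall f, L f = f - k *: P f) ->
  (forall e, LF e = e - k *: PF e) -> restricts L LF.
Proof.
move=> [lP PE] LE LFE; split=> [|e]; last by rewrite LE LFE -PE.
have -> : L = fun f => 1 *: id f + (- k) *: P f.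
  by apply/funext => f; rewrite LE scale1r scaleNr.
by apply: local_comb lP; exact: local_id.
Qed.

Lemma restricts_comp (P L : fct -> fct) (PF LF : fs -> fs) :
  restricts P PF -> restricts L LF -> restricts (P \o L) (PF \o LF).
Proof.
move=> [lP PE] [lL LE]; split=> [|e]; first exact: local_comp.
by rewrite /= PE LE.
Qed.

Lemma restricts_shift (T S : fct -> fct) (TF SF : fs -> fs) (x : R) :
  restricts T TF -> (forall f, S f = T f - x *: f) ->
  (forall e, SF e = TF e - x *: e) -> restricts S SF.
Proof.
move=> [lT TE] SE SFE; split=> [|e]; last by rewrite SE SFE -TE.
have -> : S = fun f => 1 *: T f + (- x) *: id f.
  by apply/funext => f; rewrite SE scale1r scaleNr.
by apply: local_comb lT _; exact: local_id.
Qed.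

Lemma sq_bounded_ge0 f (M : R) : sq_bounded f M -> 0 <= M.
Proof. by move/(_ fset0); rewrite /sqsum big_seq_fset0. Qed.

Lemma sq_bounded0 f : sq_bounded f 0 -> f = 0.
Proof.
move=> f0; apply/funext => v; apply/eqP; rewrite -(@sqrf_eq0 R) eq_le sqr_ge0 andbT.
exact: sq_bounded_val f0.
Qed.

Lemma sqsumZ X (a : R) f : sqsum X (a *: f) = a ^+ 2 * sqsum X f.
Proof. by rewrite /sqsum mulr_sumr; apply: eq_bigr => v _; rewrite -exprMn. Qed.

Lemma sq_boundedZ (a M : R) f : sq_bounded f M -> sq_bounded (a *: f) (a ^+ 2 * M).
Proof. by move=> fM X; rewrite sqsumZ; apply: ler_wpM2l (fM X); exact: sqr_ge0. Qed.

Lemma sq_boundedB f g (M N : R) : sq_bounded f M -> sq_bounded g N ->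
  sq_bounded (f - g) (2 * M + 2 * N).
Proof.
move=> fM gN X; apply: (@le_trans _ _ (2 * sqsum X f + 2 * sqsum X g)).
  rewrite /sqsum !mulr_sumr -big_split; apply: ler_sum => v _ /=.
  have -> : (f - g) v = (f v : R) - (g v : R) by [].
  have := sqr_ge0 ((f v : R) + (g v : R)); set x : R := f v; set y : R := g v.
  nra.
by apply: lerD; rewrite ler_pM2l.
Qed.

Lemma contraction_extend (L : fct -> fct) (LF : fs -> fs) (q : R) :
  restricts L LF -> 0 <= q ->
  (forall e, ip (LF e) (LF e) <= q * ip e e) ->
  forall f M, sq_bounded f M -> sq_bounded (L f) (q * M).
Proof.
move=> [lL LE] q0 h f M fM X.
have := @local_bound_extend R V L L 0 q lL lL q0 _ f M X fM.
rewrite mul0r addr0; apply=> e Y; rewrite mul0r addr0 -LE.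
by apply: le_trans (h e); exact: sq_bounded_fsip.
Qed.

Section Coercive.
Variables (P : {linear fct -> fct}) (PF : {linear fs -> fs}) (K c : R).
Hypotheses (PPF : restricts P PF) (Psym : ip_sym ip PF).
Hypotheses (K0 : 0 < K) (c0 : 0 < c).
Hypothesis PK : forall e, ip (PF e) e <= K * ip e e.
Hypothesis Pc : forall e, c * ip e e <= ip (PF e) e.

Lemma coercive_contraction : exists2 q : R, 0 < q < 1 &
  exists L : {linear fct -> fct}, [/\ local L, forall f, L f = f - K^-1 *: P f &
    forall f M, sq_bounded f M -> sq_bounded (L f) (q ^+ 2 * M)].
Proof.
have [L LE] := linear_relax P K^-1; have [LF LFE] := linear_relax PF K^-1.
have LL := restricts_relax PPF LE LFE.
(* The cap [K / 2] keeps [1 - d / K] away from 0, so that the ratio [q] is positive. *)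
pose d := Num.min c (K / 2).
have d0 : 0 < d by rewrite /d lt_min c0 /= divr_gt0.
have dK : d / K <= 1 / 2.
  by rewrite ler_pdivrMr // mul1r mulrC /d ge_min lexx orbT.
have dK0 : 0 < d / K by rewrite divr_gt0.
exists (Num.sqrt (1 - d / K)).
  rewrite sqrtr_gt0 -[X in _ && (_ < X)]sqrtr1 ltr_sqrt //.
  by apply/andP; split; lra.
exists L; split=> //; first exact: LL.1.
rewrite sqr_sqrtr; last by lra.
apply: (contraction_extend LL) => [|e]; first by lra.
have P0 h : 0 <= ip (PF h) h.
  by apply: le_trans (Pc h); rewrite mulr_ge0 ?fsip_ge0 // ltW.
have := psd_contraction (@fsipC R V) (@fsip_linl R V) K0
  (psd_norm (@fsipC R V) (@fsip_linl R V) K0 Psym P0 PK) e.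
rewrite -!LFE.
have h1 : d * ip e e <= ip (PF e) e.
  apply: le_trans (Pc e); apply: ler_wpM2r; first exact: fsip_ge0.
  by rewrite /d ge_min lexx.
have h2 : d / K * ip e e <= K^-1 * ip (PF e) e.
  rewrite mulrAC mulrC ler_pM2l ?invr_gt0 //.
move: h2; lra.
Qed.

(** A kernel vector is fixed by the strict contraction [L], so its squared norm is at most
    [M * (q ^+ 2) ^+ n] for every [n]. *)
Lemma coercive_inj g (M : R) : sq_bounded g M -> P g = 0 -> g = 0.
Proof.
have [q /andP[q0 q1] [L [lL LE Lq]]] := coercive_contraction => gM Pg.
have Lg : L g = g by rewrite LE Pg scaler0 subr0.
have gn n : sq_bounded g (M * (q ^+ 2) ^+ n).
  elim: n => [|n IH]; first by rewrite expr0 mulr1.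
  by rewrite -Lg exprS mulrCA; apply: Lq.
apply: sq_bounded0 => X.
have : (fun n => M * (q ^+ 2) ^+ n) @ \oo --> (0 : R).
  apply: (@cvg_geometric R); rewrite ger0_norm ?sqr_ge0 //.
  by rewrite expr_lt1 // ltW.
by move=> /cvgr_to_ge; apply; apply: nearW => n; exact: gn.
Qed.

(** As [L = 1 - K^-1 P], the equation [P g = f] reads [g - L g = K^-1 f], which the Neumann series
    solves. *)
Lemma coercive_surj : exists2 C : R, 0 < C &
  forall f M, sq_bounded f M -> exists2 g, sq_bounded g (C * M) & P g = f.
Proof.
have [q /andP[q0 q1] [L [lL LE Lq]]] := coercive_contraction.
have q1' : 0 < 1 - q by rewrite subr_gt0.
exists ((K * (1 - q)) ^- 2) => [|f M fM].
  by rewrite invr_gt0 exprn_gt0 // mulr_gt0.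
(* [neumann_series] requires a positive bound, so [M = 0] is treated apart. *)
have [M0|M0] := leP M 0.
  have M00 : M = 0 by apply/eqP; rewrite eq_le M0 (sq_bounded_ge0 fM).
  exists 0; last by rewrite linear0; apply/esym/sq_bounded0; rewrite -M00.
  by move=> X; rewrite M00 mulr0 /sqsum big1 // => v _; rewrite expr0n.
have [|||g [gb gE]] := @neumann_series R V L (K^-1 *: f) q (K^-1 * Num.sqrt M) lL.
- by rewrite q0 q1.
- by rewrite mulr_gt0 ?invr_gt0 // sqrtr_gt0.
- elim=> [|n IH].
    rewrite expr0 mul1r exprMn sqr_sqrtr ?ltW //; exact: sq_boundedZ.
  by rewrite iterS (exprS q) -mulrA exprMn; apply: Lq.
exists g.
  apply: sq_bounded_le gb; rewrite -[X in _ <= _ * X](sqr_sqrtr (ltW M0)).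
  rewrite le_eqVlt; apply/orP; left; apply/eqP; field.
  by rewrite !gt_eqF.
move: gE; rewrite LE subKr => /(congr1 (fun h => K *: h)).
by rewrite !scalerA divff ?gt_eqF // !scale1r.
Qed.

End Coercive.

Section NearKernel.
Variables (S : {linear fct -> fct}) (SF : {linear fs -> fs}) (K : R).
Hypotheses (SSF : restricts S SF) (Ssym : ip_sym ip SF) (K0 : 0 < K).
Hypothesis SK : forall e, ip (SF e) (SF e) <= K * ip e e.

Lemma square_contraction e :
  ip (e - K^-1 *: SF (SF e)) (e - K^-1 *: SF (SF e)) + K^-1 * ip (SF e) (SF e)
    <= ip e e.
Proof.
have P2 h : ip ((SF \o SF) h) ((SF \o SF) h) <= K * ip ((SF \o SF) h) h.
  by rewrite /= (Ssym (SF h) h); exact: SK.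
have := psd_contraction (@fsipC R V) (@fsip_linl R V) K0 P2 e.
by rewrite /= (Ssym (SF e) e).
Qed.

(** Formally [|S g|^2 = <S^2 g, g> = 0], but the form is defined on finite supports only. Instead,
    [L = 1 - K^-1 S^2] fixes [g], and [square_contraction] extended to [g] reads
    [|g|^2 + K^-1 |S g|^2 <= |g|^2]. *)
Lemma ker_square g (M : R) : sq_bounded g M -> S (S g) = 0 -> S g = 0.
Proof.
move=> gM SSg.
(* The argument needs the exact squared norm of [g], recovered as a supremum; the bound [M] may be
   too large. *)
pose A := [set sqsum X g | X in [set: {fset V}]].
have Asup : has_sup A.
  by split; [exists (sqsum fset0 g), fset0 | exists M => _ [X _ <-]].
have gA : sq_bounded g (sup A).
  by move=> X; apply: sup_upper_bound => //; exists X.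
have [L LE] := linear_relax (S \o S) K^-1.
have [LF LFE] := linear_relax (SF \o SF) K^-1.
have LL := restricts_relax (restricts_comp SSF SSF) LE LFE.
have Lg : L g = g by rewrite LE /= SSg scaler0 subr0.
apply: sq_bounded0 => X; rewrite leNgt; apply/negP => X0.
suff : sup A <= sup A - K^-1 * sqsum X (S g).
  by apply/negP; rewrite -ltNge gtrBl mulr_gt0 ?invr_gt0.
apply: ge_sup; first by exists (sqsum fset0 g), fset0.
move=> _ [Y _ <-]; rewrite lerBrDr.
have Ki : 0 <= K^-1 by rewrite invr_ge0 ltW.
have := @local_bound_extend R V L S K^-1 1 LL.1 SSF.1 ler01 _ g _ (X `|` Y)%fset gA.
rewrite Lg mul1r => h; apply: le_trans (h _); last first.
  move=> e Z; rewrite mul1r -LL.2 -SSF.2; apply: le_trans (square_contraction e).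
  rewrite LFE; apply: lerD; first exact: sq_bounded_fsip.
  by apply: ler_wpM2l => //; exact: sq_bounded_fsip.
apply: lerD; first by apply: sqsum_sub; exact: fsubsetUr.
by apply: ler_wpM2l => //; apply: sqsum_sub; exact: fsubsetUl.
Qed.

(* Subtracting [g := \sum_n (1 - K^-1 S^2)^n (K^-1 S^2 e)] from [e] gives a vector
   of the kernel; by the spectral gap the series is dominated by a geometric one. *)
Lemma near_kernel (r : R) : 0 < r ->
  (forall e, r * ip (SF e) e <= ip (SF e) (SF e)) ->
  (forall e, - r * ip (SF e) e <= ip (SF e) (SF e)) ->
  exists2 C : R, 0 < C & forall e d, 0 < d -> ip (SF e) (SF e) <= d ->
    exists2 g, sq_bounded g (C * d) & S (fsval e - g) = 0.
Proof.
move=> r0 h1 h2.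
have gap := spectral_gap (@fsipC R V) (@fsip_linl R V) Ssym h1 h2.
have [L LE] := linear_relax (S \o S) K^-1.
have [LF LFE] := linear_relax (SF \o SF) K^-1.
have LL := restricts_relax (restricts_comp SSF SSF) LE LFE.
(* [r ^+ 2 / K] is the rate given by the gap; the cap [1 / 2] keeps [q] positive. *)
pose t := Num.min (r ^+ 2 / K) (1 / 2).
have t0 : 0 < t by rewrite /t lt_min !divr_gt0 // exprn_gt0.
have t1 : t <= 1 / 2 by rewrite /t ge_min lexx orbT.
have tr : t <= r ^+ 2 / K by rewrite /t ge_min lexx.
pose q := Num.sqrt (1 - t).
have q01 : 0 < q < 1.
  rewrite sqrtr_gt0 -[X in _ && (_ < X)]sqrtr1 ltr_sqrt //.
  by apply/andP; split; lra.
have q2 : q ^+ 2 = 1 - t by rewrite sqr_sqrtr //; lra.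
have /andP[q0 q1] := q01.
have q1' : 0 < 1 - q by rewrite subr_gt0.
exists (K * (1 - q) ^+ 2)^-1 => [|e d d0 ed].
  by rewrite invr_gt0 mulr_gt0 // exprn_gt0.
(* [LF] commutes with [SF], so every term of the series stays in the range of [SF \o SF], where
   [gap] applies. *)
pose e0 n := K^-1 *: SF (SF (iter n LF e)).
have LFS h : LF (SF h) = SF (LF h).
  by rewrite !LFE /= linearB [SF (K^-1 *: _)]linearZ.
have e0E n : e0 n = iter n L (K^-1 *: S (S e)) :> fct.
  elim: n => [|n IH]; first by rewrite /e0 /= -!SSF.2.
  by rewrite iterS -IH -LL.2 /e0 linearZ /= !LFS.
have e0b n : ip (e0 n) (e0 n) <= (q ^+ n * Num.sqrt (d / K)) ^+ 2.
  have dK : 0 <= d / K by rewrite divr_ge0 // ltW.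
  elim: n => [|n IH].
    rewrite expr0 mul1r sqr_sqrtr // /e0 /=.
    rewrite (ipZl (@fsip_linl R V)) (ipZr (@fsipC R V) (@fsip_linl R V)) mulrA.
    rewrite [leRHS]mulrC -mulrA ler_pM2l ?invr_gt0 // mulrC ler_pdivrMr //.
    by apply: le_trans (SK _) _; rewrite mulrC ler_pM2r.
  rewrite (exprS q) -mulrA exprMn q2.
  apply: le_trans (_ : (1 - t) * ip (e0 n) (e0 n) <= _); last first.
    by apply: ler_wpM2l IH; lra.
  have -> : e0 n.+1 = LF (e0 n) by rewrite /e0 linearZ /= !LFS.
  have := square_contraction (e0 n); rewrite LFE /=.
  have : r ^+ 2 * ip (e0 n) (e0 n) <= ip (SF (e0 n)) (SF (e0 n)).
    rewrite /e0 linearZ /= !(ipZl (@fsip_linl R V)).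
    rewrite !(ipZr (@fsipC R V) (@fsip_linl R V)).
    rewrite mulrCA ler_pM2l ?invr_gt0 // mulrCA ler_pM2l ?invr_gt0 //.
  set a := ip (e0 n) (e0 n); set b := ip (SF _) _ => ab.
  have h3 : t * a <= K^-1 * b.
    apply: le_trans (_ : r ^+ 2 / K * a <= _).
      by apply: ler_wpM2r => //; exact: fsip_ge0.
    by rewrite mulrAC mulrC ler_pM2l ?invr_gt0.
  by move: h3; lra.
have [||g [gb gE]] := @neumann_series R V L (K^-1 *: S (S e)) q
    (Num.sqrt (d / K)) LL.1 q01.
- by rewrite sqrtr_gt0 divr_gt0.
- move=> n; rewrite -e0E; apply: sq_bounded_le (e0b n) _; exact: sq_bounded_fsip.
have gb' : sq_bounded g ((K * (1 - q) ^+ 2)^-1 * d).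
  apply: sq_bounded_le gb; rewrite exprMn sqr_sqrtr; last by rewrite divr_ge0 // ltW.
  rewrite le_eqVlt; apply/orP; left; apply/eqP; field.
  by rewrite !gt_eqF.
exists g => //.
(* [g - L g = K^-1 S^2 g], so the series solves [S^2 g = S^2 e]; [ker_square] then removes one
   factor [S]. *)
have SSg : S (S (fsval e - g)) = 0.
  rewrite !linearB /=; apply/eqP; rewrite subr_eq0; apply/eqP/esym.
  move: gE; rewrite LE subKr => /(congr1 (fun h => K *: h)).
  by rewrite !scalerA divff ?gt_eqF // !scale1r.
exact: ker_square (sq_boundedB (@sq_bounded_fsip _ _ e) gb') SSg.
Qed.

End NearKernel.
End LocalOperators.

(** * Complex square-summable functions *)

Section ComplexParts.
Variable R : realType.
Local Notation C := (cplx R).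

Definition cre (z : C) : R := complex.Re z.
Definition cim (z : C) : R := complex.Im z.
Definition rc (x : R) : C := x%:C%C.
Definition mkc (x y : R) : C := (x +i* y)%C.

Lemma cplx_ext (z w : C) : cre z = cre w -> cim z = cim w -> z = w.
Proof. by case: z => a b; case: w => c d /= -> ->. Qed.

Lemma creD z w : cre (z + w) = cre z + cre w. Proof. by case: z; case: w. Qed.
Lemma cimD z w : cim (z + w) = cim z + cim w. Proof. by case: z; case: w. Qed.
Lemma creN z : cre (- z) = - cre z. Proof. by case: z. Qed.
Lemma cimN z : cim (- z) = - cim z. Proof. by case: z. Qed.
Lemma creM z w : cre (z * w) = cre z * cre w - cim z * cim w.
Proof. by case: z; case: w. Qed.
Lemma cimM z w : cim (z * w) = cre z * cim w + cim z * cre w.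
Proof. by case: z; case: w. Qed.
Lemma cre0 : cre 0 = 0. Proof. by []. Qed.
Lemma cim0 : cim 0 = 0. Proof. by []. Qed.
Lemma cre_rc x : cre (rc x) = x. Proof. by []. Qed.
Lemma cim_rc x : cim (rc x) = 0. Proof. by []. Qed.

Definition cE := (creD, cimD, creN, cimN, creM, cimM, cre_rc, cim_rc, cre0, cim0).

Lemma cre_sum (I : Type) (r : seq I) (P : pred I) (F : I -> C) :
  cre (\sum_(i <- r | P i) F i) = \sum_(i <- r | P i) cre (F i).
Proof. exact: (big_morph _ creD cre0). Qed.

Lemma cim_sum (I : Type) (r : seq I) (P : pred I) (F : I -> C) :
  cim (\sum_(i <- r | P i) F i) = \sum_(i <- r | P i) cim (F i).
Proof. exact: (big_morph _ cimD cim0). Qed.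

End ComplexParts.

Section SquareSummable.
Variables (R : realType) (V : choiceType).
Local Notation C := (cplx R).
Local Notation fct := (V -> R^o).
Implicit Types (psi phi : V -> C) (X : {fset V}) (M : R).

Definition refct psi : fct := fun v => cre (psi v).
Definition imfct psi : fct := fun v => cim (psi v).

Definition csq_bounded psi M :=
  forall X, sqsum X (refct psi) + sqsum X (imfct psi) <= M.

Lemma l2normsq_ge0 psi : (0 <= l2normsq psi)%E.
Proof. by apply: esum_ge0 => v _; rewrite lee_fin addr_ge0 ?sqr_ge0. Qed.

(** The extended sum is a supremum of finite partial sums; this is the bridge between [l2] and the
    bounds used above. *)
Lemma l2normsq_le psi M : (l2normsq psi <= M%:E)%E <-> csq_bounded psi M.
Proof.
have E X : (\sum_(v \in [set` X]) ((complex.Re (psi v)) ^+ 2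
    + (complex.Im (psi v)) ^+ 2)%:E)%E
    = (sqsum X (refct psi) + sqsum X (imfct psi))%:E.
  by rewrite -fsbig_seq ?fset_uniq // sumEFin /sqsum -big_split.
split=> [h X|h].
  rewrite -lee_fin -E; apply: le_trans h; apply: ereal_sup_ubound.
  by exists [set` X] => //; split.
apply: ge_ereal_sup => _ [A [finA _] <-].
have -> : A = [set` fset_set A] by rewrite fset_setK.
by rewrite E lee_fin.
Qed.

Lemma l2_bounded psi : l2 psi -> csq_bounded psi (l2norm psi ^+ 2).
Proof.
move=> h; apply/l2normsq_le; have h0 := l2normsq_ge0 psi.
by rewrite sqr_sqrtr ?fine_ge0 // fineK // ge0_fin_numE.
Qed.

Lemma bounded_l2 psi M : csq_bounded psi M -> l2 psi.
Proof. by move/l2normsq_le => h; rewrite /l2 /=; apply: le_lt_trans h (ltry M). Qed.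

Lemma l2norm_le psi M : csq_bounded psi M -> l2norm psi ^+ 2 <= M.
Proof.
move=> h; have l := bounded_l2 h; have h0 := l2normsq_ge0 psi.
rewrite sqr_sqrtr ?fine_ge0 // -lee_fin fineK ?ge0_fin_numE //.
exact/l2normsq_le.
Qed.

Lemma l2norm_ge0 psi : 0 <= l2norm psi. Proof. exact: sqrtr_ge0. Qed.

Lemma csq_bounded_re psi M : csq_bounded psi M -> sq_bounded (refct psi) M.
Proof. by move=> h X; apply: le_trans (h X); rewrite lerDl sqsum_ge0. Qed.

Lemma csq_bounded_im psi M : csq_bounded psi M -> sq_bounded (imfct psi) M.
Proof. by move=> h X; apply: le_trans (h X); rewrite lerDr sqsum_ge0. Qed.

Lemma csq_boundedD psi M N : sq_bounded (refct psi) M ->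
  sq_bounded (imfct psi) N -> csq_bounded psi (M + N).
Proof. by move=> h k X; apply: lerD. Qed.

End SquareSummable.

Section Spectrum.
Variables (R : realType) (V : choiceType).
Local Notation C := (cplx R).
Local Notation fct := (V -> R^o).
Local Notation fs := (fsfct R V).
Local Notation ip := (@fsip R V).
Variables (T : (V -> C) -> (V -> C)) (Tr : {linear fct -> fct}).
Variable TF : {linear fs -> fs}.
Variable K : R.
Hypotheses (Tre : forall psi, refct (T psi) = Tr (refct psi))
  (Tim : forall psi, imfct (T psi) = Tr (imfct psi)).
Hypotheses (TTF : restricts Tr TF) (Tsym : ip_sym ip TF) (K0 : 0 < K).
Hypothesis TK : forall e, ip (TF e) (TF e) <= K * ip e e.
Implicit Types (psi phi : V -> C) (f g : fct) (e : fs) (X : {fset V}).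

Lemma fct_ext psi phi : refct psi = refct phi -> imfct psi = imfct phi -> psi = phi.
Proof.
move=> h1 h2; apply/funext => v.
by apply: cplx_ext; [exact: (congr1 (@^~ v) h1)|exact: (congr1 (@^~ v) h2)].
Qed.

Lemma refct_comb (a : C) psi phi : refct (fun v => a * psi v + phi v) =
  cre a *: refct psi - cim a *: imfct psi + refct phi.
Proof. by apply/funext => v; rewrite /refct !cE. Qed.

Lemma imfct_comb (a : C) psi phi : imfct (fun v => a * psi v + phi v) =
  cre a *: imfct psi + cim a *: refct psi + imfct phi.
Proof. by apply/funext => v; rewrite /imfct !cE. Qed.

Lemma op_linear (a : C) psi phi :
  T (fun v => a * psi v + phi v) = fun v => a * T psi v + T phi v.
Proof.
apply: fct_ext.
  by rewrite Tre !refct_comb !Tre !Tim linearD linearB !linearZ.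
by rewrite Tim !imfct_comb !Tre !Tim !linearD !linearZ.
Qed.

Lemma shift_linear z (a : C) psi phi :
  shift_op T z (fun v => a * psi v + phi v)
    = fun v => a * shift_op T z psi v + shift_op T z phi v.
Proof. by apply/funext => v; rewrite /shift_op op_linear; ring. Qed.

Section Shifted.
Variables (x y : R) (S : {linear fct -> fct}) (SF : {linear fs -> fs}).
Hypotheses (SE : forall f, S f = Tr f - x *: f) (SFE : forall e, SF e = TF e - x *: e).

Lemma shift_restricts : restricts S SF.
Proof. exact: restricts_shift TTF SE SFE. Qed.

Lemma shift_sym : ip_sym ip SF.
Proof.
move=> e h; rewrite !SFE.
by rewrite !(ipE (@fsipC R V) (@fsip_linl R V)) Tsym.
Qed.

Lemma shift_form_bounded e : ip (SF e) (SF e) <= (2 * K + 2 * x ^+ 2) * ip e e.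
Proof.
have := fsip_ge0 (TF e + x *: e); have := TK e.
rewrite SFE !(ipE (@fsipC R V) (@fsip_linl R V)) (fsipC e (TF e)); nra.
Qed.

Lemma shift_const_gt0 : 0 < 2 * K + 2 * x ^+ 2.
Proof. by have := sqr_ge0 x; have := K0; lra. Qed.

Lemma shift_bounded f M : sq_bounded f M ->
  sq_bounded (S f) ((2 * K + 2 * x ^+ 2) * M).
Proof.
apply: (contraction_extend shift_restricts _ shift_form_bounded).
exact: ltW shift_const_gt0.
Qed.

Lemma re_shift psi : refct (shift_op T (mkc x y) psi)
  = S (refct psi) + y *: imfct psi.
Proof.
rewrite SE -Tre; apply/funext => v; rewrite /refct /shift_op !cE /=.
by rewrite opprB addrA addrAC.
Qed.

Lemma im_shift psi : imfct (shift_op T (mkc x y) psi)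
  = S (imfct psi) - y *: refct psi.
Proof.
rewrite SE -Tim; apply/funext => v; rewrite /imfct /shift_op !cE /=.
by rewrite opprD addrA.
Qed.

(* [S^2 + y^2] is real and equals [(T - z)^* (T - z)] for [z = x + i y]; once it is
   inverted, so is [T - z]. *)
Lemma resolvent_of_coercive (c : R) : 0 < c ->
  (forall e, c * ip e e <= ip (SF e) (SF e) + y ^+ 2 * ip e e) ->
  resolvent_set T (mkc x y).
Proof.
move=> c0 Sc.
have [P PE] := linear_shift (S \o S) (- y ^+ 2).
have [PF PFE] := linear_shift (SF \o SF) (- y ^+ 2).
have PP : restricts P PF.
  exact: restricts_shift (restricts_comp shift_restricts shift_restricts) PE PFE.
have Pip e h : ip (PF e) h = ip (SF e) (SF h) + y ^+ 2 * ip e h.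
  rewrite PFE /= scaleNr opprK.
  by rewrite !(ipE (@fsipC R V) (@fsip_linl R V)) (shift_sym (SF e) h).
have Psym : ip_sym ip PF.
  by move=> d h; rewrite [RHS]fsipC !Pip (fsipC (SF h)) (fsipC h).
have k0 := shift_const_gt0; set k := 2 * K + 2 * x ^+ 2 in k0.
have ky0 : 0 < k + y ^+ 2 by rewrite ltr_wpDr ?sqr_ge0.
have Pk e : ip (PF e) e <= (k + y ^+ 2) * ip e e.
  by rewrite Pip mulrDl lerD2r shift_form_bounded.
have Pc e : c * ip e e <= ip (PF e) e by rewrite Pip.
have inj := coercive_inj PP Psym ky0 c0 Pk Pc.
have [D D0 surj] := coercive_surj PP Psym ky0 c0 Pk Pc.
have PfE f : P f = S (S f) + y ^+ 2 *: f by rewrite PE /= scaleNr opprK.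
pose z := mkc x y.
have shift0 psi : l2 psi -> shift_op T z psi = (fun=> 0) -> psi = (fun=> 0).
  move=> l h; have bd := l2_bounded l.
  have hr : S (refct psi) + y *: imfct psi = 0 by rewrite -re_shift h.
  have hi : S (imfct psi) - y *: refct psi = 0 by rewrite -im_shift h.
  have Si : S (imfct psi) = y *: refct psi by apply/eqP; rewrite -subr_eq0 hi.
  have Sr : S (refct psi) = - (y *: imfct psi) by apply/eqP; rewrite -addr_eq0 hr.
  apply: fct_ext.
    apply: (inj _ _ (csq_bounded_re bd)).
    by rewrite PfE Sr linearN linearZ Si /= scalerA expr2 addNr.
  apply: (inj _ _ (csq_bounded_im bd)).
  by rewrite PfE Si linearZ Sr /= scalerN scalerA expr2 addNr.
(* One summand for each of the real and imaginary parts of [phi]: [k] bounds [S], [D] bounds the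
   inverse of [P], and the factors 2 come from [sq_boundedB]. *)
pose Cst := (2 * k * D + 2 * (y ^+ 2 * D)) + (2 * k * D + 2 * (y ^+ 2 * D)).
have solve psi : l2 psi -> exists phi, csq_bounded phi (Cst * l2norm psi ^+ 2) /\
    shift_op T z phi = psi.
  move=> l; have bd := l2_bounded l.
  have [h1 h1b h1E] := surj _ _ (csq_bounded_re bd).
  have [h2 h2b h2E] := surj _ _ (csq_bounded_im bd).
  (* This is [T - conj z = S + i y] applied to the solution [h1 + i h2] of [P h = psi]. *)
  exists (fun v => mkc ((S h1 - y *: h2) v) ((S h2 + y *: h1) v)); split.
    rewrite /Cst mulrDl; apply: csq_boundedD.
      apply: sq_bounded_le (sq_boundedB (shift_bounded h1b) (sq_boundedZ y h2b)).
      by rewrite -/k le_eqVlt; apply/orP; left; apply/eqP; ring.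
    have -> : imfct (fun v => mkc ((S h1 - y *: h2) v) ((S h2 + y *: h1) v))
      = S h2 - (- y) *: h1 by rewrite scaleNr opprK.
    apply: sq_bounded_le (sq_boundedB (shift_bounded h2b) (sq_boundedZ (- y) h1b)).
    by rewrite -/k sqrrN le_eqVlt; apply/orP; left; apply/eqP; ring.
  apply: fct_ext.
    rewrite re_shift -h1E PfE.
    have -> : refct (fun v => mkc ((S h1 - y *: h2) v) ((S h2 + y *: h1) v))
      = S h1 - y *: h2 by [].
    have -> : imfct (fun v => mkc ((S h1 - y *: h2) v) ((S h2 + y *: h1) v))
      = S h2 + y *: h1 by [].
    by rewrite linearB [S (y *: _)]linearZ scalerDr scalerA addrA subrK expr2.
  rewrite im_shift -h2E PfE.
  have -> : refct (fun v => mkc ((S h1 - y *: h2) v) ((S h2 + y *: h1) v))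
    = S h1 - y *: h2 by [].
  have -> : imfct (fun v => mkc ((S h1 - y *: h2) v) ((S h2 + y *: h1) v))
    = S h2 + y *: h1 by [].
  rewrite linearD [S (y *: _)]linearZ scalerBr scalerA opprB addrACA.
  by rewrite subrr addr0 expr2.
have /choice[B0 B0E] : forall psi, exists phi, l2 psi ->
    csq_bounded phi (Cst * l2norm psi ^+ 2) /\ shift_op T z phi = psi.
  move=> psi.
  have [l|nl] := pselect (l2 psi); last by exists psi.
  by have [phi ?] := solve _ l; exists phi.
have l2comb (a : C) psi phi : l2 psi -> l2 phi -> l2 (fun v => a * psi v + phi v).
  move=> l l'; have b := l2_bounded l; have b' := l2_bounded l'.
  have [br bi] := (csq_bounded_re b, csq_bounded_im b).
  have [br' bi'] := (csq_bounded_re b', csq_bounded_im b').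
  apply: bounded_l2; apply: csq_boundedD.
    rewrite refct_comb -[refct phi]opprK.
    apply: sq_boundedB; last by rewrite -scaleN1r; exact: sq_boundedZ br'.
    by apply: sq_boundedB; [exact: sq_boundedZ br|exact: sq_boundedZ bi].
  rewrite imfct_comb -[imfct phi]opprK -[X in _ + X - _]opprK.
  apply: sq_boundedB; last by rewrite -scaleN1r; exact: sq_boundedZ bi'.
  apply: sq_boundedB; first exact: sq_boundedZ bi.
  by rewrite -scaleNr; exact: sq_boundedZ br.
have l2B0 psi : l2 psi -> l2 (B0 psi) by move=> /B0E[/bounded_l2].
have uniq psi phi : l2 psi -> l2 phi -> shift_op T z psi = shift_op T z phi ->
    psi = phi.
  move=> l l' E.
  have := shift0 _ (l2comb (-1) _ _ l l').
  rewrite shift_linear E => h.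
  have /h {}h : (fun v => -1 * shift_op T z phi v + shift_op T z phi v) = (fun=> 0).
    by apply/funext => v; rewrite mulN1r addNr.
  apply/funext => v; have := congr1 (@^~ v) h; rewrite /= mulN1r addrC => /eqP.
  by rewrite subr_eq0 => /eqP.
have l2shift psi : l2 psi -> l2 (shift_op T z psi).
  move=> l; have bd := l2_bounded l.
  have [br bi] := (csq_bounded_re bd, csq_bounded_im bd).
  apply: bounded_l2; apply: csq_boundedD.
    have -> : refct (shift_op T z psi) = S (refct psi) - (- y) *: imfct psi.
      by rewrite re_shift scaleNr opprK.
    apply: sq_boundedB; [exact: shift_bounded br|exact: sq_boundedZ bi].
  rewrite im_shift.
  apply: sq_boundedB; [exact: shift_bounded bi|exact: sq_boundedZ br].
exists B0; split; last first.
  move=> psi l; split; last by have [] := B0E _ l.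
  apply: uniq => //; first exact/l2B0/l2shift.
  by have [] := B0E _ (l2shift _ l).
split=> //.
  (* [B0] comes from a choice, so its linearity is deduced from the injectivity of [shift_op T z] on
     [l2]. *)
  move=> a f g lf lg; apply: uniq; [exact/l2B0/l2comb|apply: l2comb; exact: l2B0|].
  rewrite shift_linear; have [_ ->] := B0E _ (l2comb a f g lf lg).
  by have [_ ->] := B0E _ lf; have [_ ->] := B0E _ lg.
exists (Num.sqrt Cst) => f lf.
have [/l2norm_le h _] := B0E _ lf.
have Cst0 : 0 <= Cst.
  have kD : 0 <= k * D by rewrite mulr_ge0 // ltW.
  have yD : 0 <= y ^+ 2 * D by rewrite mulr_ge0 ?sqr_ge0 // ltW.
  by rewrite /Cst; lra.
rewrite -(ler_sqr (R := R)) ?nnegrE ?mulr_ge0 ?sqrtr_ge0 ?l2norm_ge0 //.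
by rewrite exprMn (sqr_sqrtr Cst0).
Qed.

End Shifted.
End Spectrum.

(** * Essential spectrum *)

Section EssentialSpectrum.
Variables (R : realType) (V : choiceType).
Local Notation C := (cplx R).
Local Notation fct := (V -> R^o).
Local Notation fs := (fsfct R V).
Local Notation ip := (@fsip R V).
Variables (T : (V -> C) -> (V -> C)) (Tr : {linear fct -> fct}).
Variable TF : {linear fs -> fs}.
Variable K : R.
Hypotheses (Tre : forall psi, refct (T psi) = Tr (refct psi))
  (Tim : forall psi, imfct (T psi) = Tr (imfct psi)).
Hypotheses (TTF : restricts Tr TF) (Tsym : ip_sym ip TF) (K0 : 0 < K).
Hypothesis TK : forall e, ip (TF e) (TF e) <= K * ip e e.
Implicit Types (psi phi : V -> C) (f g : fct) (e : fs) (X : {fset V}).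

Definition bounded_below (x : R) := exists2 c, 0 < c &
  forall e, c * ip e e <= ip (TF e - x *: e) (TF e - x *: e).

Lemma resolvent_nonreal (x y : R) : y != 0 -> resolvent_set T (mkc x y).
Proof.
move=> y0; have [S SE] := linear_shift Tr x; have [SF SFE] := linear_shift TF x.
apply: (resolvent_of_coercive Tre Tim TTF Tsym K0 TK SE SFE (c := y ^+ 2)).
  by rewrite exprn_even_gt0.
by move=> e; rewrite lerDr fsip_ge0.
Qed.

Lemma resolvent_bounded_below (x : R) : bounded_below x -> resolvent_set T (rc x).
Proof.
move=> [c c0 h]; have [S SE] := linear_shift Tr x; have [SF SFE] := linear_shift TF x.
apply: (resolvent_of_coercive Tre Tim TTF Tsym K0 TK SE SFE (y := 0) c0).
by move=> e; rewrite expr0n mul0r addr0 SFE.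
Qed.

Lemma bounded_below_resolvent (x : R) : resolvent_set T (rc x) -> bounded_below x.
Proof.
move=> [B [[_ _ [k kB]] BE]].
(* [e = B ((T - x) e)] gives [|e| <= k |(T - x) e|]; adding 1 allows for [k = 0]. *)
exists (k ^+ 2 + 1)^-1; first by rewrite invr_gt0 ltr_wpDl ?sqr_ge0.
move=> e; rewrite -ler_pdivlMl ?invr_gt0 ?ltr_wpDl ?sqr_ge0 // invrK.
pose psi v : C := rc (e v).
have rp : refct psi = e by [].
have ip0 : imfct psi = 0 by [].
have bd : csq_bounded psi (ip e e).
  rewrite -[ip e e]addr0; apply: csq_boundedD; first exact: sq_bounded_fsip.
  by move=> X; rewrite ip0 /sqsum big1 // => v _; rewrite expr0n.
have lp := bounded_l2 bd.
have n1 : ip e e <= l2norm psi ^+ 2.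
  have [X eX] := fsfct_supp e; rewrite (fsip_sqsum eX) -rp.
  exact: csq_bounded_re (l2_bounded lp) X.
have [S SE] := linear_shift Tr x; have [SF SFE] := linear_shift TF x.
have SS := shift_restricts TTF SE SFE.
have Sbd : csq_bounded (shift_op T (rc x) psi) (ip (SF e) (SF e)).
  rewrite -[ip _ _]addr0; apply: csq_boundedD.
    have -> : refct (shift_op T (rc x) psi) = SF e.
      have := re_shift Tre 0 SE psi; rewrite scale0r addr0 SS.2.
      exact.
    exact: sq_bounded_fsip.
  have -> : imfct (shift_op T (rc x) psi) = 0.
    have := im_shift Tim 0 SE psi; rewrite scale0r subr0 ip0 linear0.
    exact.
  by move=> X; rewrite /sqsum big1 // => v _; rewrite expr0n.
have n2 := l2norm_le Sbd; have l2s := bounded_l2 Sbd.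
have [E _] := BE _ lp; have := kB _ l2s; rewrite E => n3.
rewrite -SFE mulrDl mul1r; apply: le_trans n1 _.
apply: (@le_trans _ _ (k ^+ 2 * l2norm (shift_op T (rc x) psi) ^+ 2)).
  rewrite -exprMn ler_sqr ?nnegrE ?l2norm_ge0 //.
  exact: le_trans (l2norm_ge0 _) n3.
apply: (@le_trans _ _ (k ^+ 2 * ip (SF e) (SF e))).
  by apply: ler_wpM2l n2; exact: sqr_ge0.
by rewrite lerDl fsip_ge0.
Qed.

Lemma spectrum_real z : spectrum T z -> z = rc (cre z) /\ ~ bounded_below (cre z).
Proof.
move=> sz; have zE : z = rc (cre z).
  apply: cplx_ext => //; rewrite cim_rc; apply/eqP; apply: contrapT => /negP y0.
  apply: sz; have -> : z = mkc (cre z) (cim z) by apply: cplx_ext.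
  exact: resolvent_nonreal.
split=> // b; apply: sz; rewrite zE; exact: resolvent_bounded_below.
Qed.

Lemma not_bounded_below_small (x d : R) : ~ bounded_below x -> 0 < d ->
  exists e, ip (TF e - x *: e) (TF e - x *: e) < d * ip e e.
Proof.
move=> nb d0; apply: contrapT => h; apply: nb; exists d => // e.
by rewrite leNgt; apply/negP => ?; apply: h; exists e.
Qed.

(** A form of Weyl's criterion: weak convergence to zero is replaced by vanishing on any prescribed
    finite set. *)
Definition singular_value (x : R) := forall d X, 0 < d -> exists e,
  [/\ 0 < ip e e, ip (TF e - x *: e) (TF e - x *: e) <= d * ip e e &
      forall v, v \in X -> e v = 0].

Lemma singular_not_bounded_below x : singular_value x -> ~ bounded_below x.
Proof.
move=> sx [c c0 h]; have [|e [e0 e1 _]] := sx (c / 2) fset0; first by rewrite divr_gt0.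
have := h e; rewrite leNgt => /negP; apply; apply: le_lt_trans e1 _.
by rewrite ltr_pM2r // ltr_pdivrMr // ltr_pMr // ltr1n.
Qed.

Lemma sqr_sum_orthogonal n (y : 'I_n -> R) :
  (forall i j, i != j -> y i * y j = 0) -> (\sum_i y i) ^+ 2 = \sum_i y i ^+ 2.
Proof.
move=> h; rewrite expr2 mulr_suml; apply: eq_bigr => i _.
rewrite mulr_sumr (bigD1 i) //= big1 ?addr0 // => j ji.
by apply: h; rewrite eq_sym.
Qed.

Lemma singular_family x d m : 0 < d -> singular_value x ->
  exists u : nat -> fs,
  (forall i, (i < m)%N -> 0 < ip (u i) (u i) /\
     ip (TF (u i) - x *: u i) (TF (u i) - x *: u i) <= d * ip (u i) (u i)) /\
  forall i j, (i < m)%N -> (j < m)%N -> i != j ->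
    forall v, (u i v : R) * (u j v : R) = 0.
Proof.
move=> d0 sx; have /choice[supp suppE] := @fsfct_supp R V.
elim: m => [|m [u [h1 h2]]]; first by exists (fun=> 0).
pose X := (\bigcup_(i <- iota 0 m) supp (u i))%fset.
have [e [e0 e1 eX]] := sx d X d0.
have uX i v : (i < m)%N -> (u i v : R) * (e v : R) = 0.
  move=> im; have [vX|vX] := boolP (v \in X); first by rewrite eX // mulr0.
  rewrite suppE ?mul0r //; apply: contra vX => vi; apply/bigfcupP; exists i => //.
  by rewrite mem_iota add0n leq0n im.
exists (fun i => if i == m then e else u i); split=> [i|i j].
  rewrite ltnS leq_eqVlt.
  have [_ _|_ im] := eqVneq i m; first by split.
  exact: h1 im.
rewrite !ltnS (leq_eqVlt i) (leq_eqVlt j).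
have [->|im] := eqVneq i m; have [->|jm] := eqVneq j m.
- by [].
- by move=> _ jm' _ v; rewrite mulrC; exact: uX.
- by move=> im' _ _ v; exact: uX.
- exact: h2.
Qed.

(** The coefficient matrix has more rows than columns, hence a nonzero left kernel vector. As the
    [k i] are real, its real and imaginary parts are both relations, and one of them is
    nontrivial. *)
Lemma real_dependence n (k : 'I_n.+1 -> fct) (h : 'I_n -> V -> C) :
  (forall i, exists c : 'I_n -> C,
     (fun v => rc (k i v)) = fun v => \sum_(j < n) c j * h j v) ->
  exists b : 'I_n.+1 -> R, (exists i, b i != 0) /\
    forall v, \sum_i b i * (k i v : R) = 0.
Proof.
move=> /choice[c cH]; pose A : 'M[C]_(n.+1, n) := \matrix_(i, j) c i j.
have : kermx A != 0.
  rewrite kermx_eq0 /row_free neq_ltn; apply/orP; left.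
  by rewrite ltnS rank_leq_col.
move=> /rowV0Pn[a /sub_kermxP aA a0].
have aE v : \sum_i a 0 i * rc (k i v) = 0.
  have ckE i : rc (k i v) = \sum_(j < n) c i j * h j v.
    exact: (congr1 (@^~ v) (cH i)).
  under eq_bigr do rewrite ckE mulr_sumr.
  rewrite exchange_big big1 //= => j _.
  under eq_bigr do rewrite mulrA.
  rewrite -mulr_suml.
  have -> : \sum_i a 0 i * c i j = (a *m A) 0 j.
    by rewrite mxE; apply: eq_bigr => i _; rewrite mxE.
  by rewrite aA mxE mul0r.
have aR v : \sum_i cre (a 0 i) * (k i v : R) = 0.
  rewrite -[RHS](cre0 R) -(aE v) cre_sum; apply: eq_bigr => i _.
  by rewrite !cE mulr0 subr0.
have aI v : \sum_i cim (a 0 i) * (k i v : R) = 0.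
  rewrite -[RHS](cim0 R) -(aE v) cim_sum; apply: eq_bigr => i _.
  by rewrite !cE mulr0 add0r.
have /rV0Pn[i ai] := a0.
have [r0|r0] := eqVneq (cre (a 0 i)) 0; last first.
  by exists (fun i => cre (a 0 i)); split; [exists i|].
exists (fun i => cim (a 0 i)); split=> //; exists i.
by apply: contra ai => /eqP i0; apply/eqP; apply: cplx_ext.
Qed.

Lemma isolated_gap x : isolated (spectrum T) (rc x) ->
  exists2 r, 0 < r & forall l, l != x -> `|l - x| < r -> bounded_below l.
Proof.
move=> [_ [U /nbhs_ballP[d /= d0 dU] UE]].
(* The radius of a ball of [cplx R] is itself an element of [cplx R]; being positive, it is real. *)
have dr : d = rc (cre d).
  apply: cplx_ext => //; rewrite cim_rc; move: d0.
  by rewrite (@ltcE R) => /andP[/eqP].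
have d0' : 0 < cre d by move: d0; rewrite (@ltcE R) => /andP[].
exists (cre d) => // l lx lxd; apply: bounded_below_resolvent.
apply: contrapT => nr; have : [set rc x] (rc l).
  rewrite -UE; split; last exact: nr.
  apply: dU; rewrite /ball /= /ball_ dr.
  have -> : rc x - rc l = rc (x - l) by apply: cplx_ext; rewrite !cE ?subr0.
  rewrite /rc (@normc_def R) /= expr0n addr0 sqrtr_sqr.
  by rewrite (@ltcE R) /= eqxx distrC.
by move=> /(congr1 (@cre R)) /= xl; rewrite xl eqxx in lx.
Qed.

(* Near an isolated point of the spectrum the form [S^2] has a gap, so singular
   vectors are close to the kernel of [S]; as their supports are disjoint, the kernel
   vectors so obtained are linearly independent. *)
Lemma singular_ess_spectrum x : singular_value x -> ess_spectrum T (rc x).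
Proof.
move=> sx; split.
  by move=> /bounded_below_resolvent; exact: singular_not_bounded_below.
move=> [/isolated_gap[r r0 gap] _ [n [h hE]]].
have [S SE] := linear_shift Tr x; have [SF SFE] := linear_shift TF x.
have SS := shift_restricts TTF SE SFE; have Ssym := shift_sym Tsym SFE.
have k0 := shift_const_gt0 K0 x; have SK := shift_form_bounded TK SFE.
(* Every [l] at distance less than [r / 2] from [d] satisfies [0 < |l| < r], so [x + l] is in the
   punctured interval of [gap]. The resulting bound [|S e - d e|^2 >= d^2 |e|^2] expands to the
   claim. *)
have form d : `|d| = r / 2 -> forall e, 2 * d * ip (SF e) e <= ip (SF e) (SF e).
  move=> dr e.
  have r20 : 0 < r / 2 by rewrite divr_gt0.
  have d2 : d * d = (r / 2) ^+ 2 by rewrite -dr real_normK ?num_real // expr2.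
  have lb l : `|l - d| < r / 2 -> exists2 c, 0 < c &
      forall e, c * ip e e <= ip (SF e - l *: e) (SF e - l *: e).
    move=> ld; have [||c c0 ce] := gap (x + l).
    - rewrite -subr_eq0 addrC addKr; apply: contraTneq ld => ->.
      by rewrite sub0r normrN dr ltxx.
    - rewrite addrC addKr -[l](subrK d); apply: le_lt_trans (ler_normD _ _) _.
      by rewrite dr; move: ld; set t := `|_|; lra.
    - exists c; first exact: c0.
      move=> e'.
      have -> : SF e' - l *: e' = TF e' - (x + l) *: e'.
        by rewrite SFE scalerDl opprD addrA.
      exact: ce.
  have := lower_bound_dist (@fsipC R V) (@fsip_linl R V) (@fsip_ge0 R V)
    k0 Ssym SK lb (ltW r20) e.
  rewrite !(ipE (@fsipC R V) (@fsip_linl R V)) (fsipC e (SF e)).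
  rewrite mulrBr (mulrA d d) d2.
  set a := ip e e; set b := ip _ e; set w := ip _ _; clearbody a b w.
  lra.
have f1 e : r * ip (SF e) e <= ip (SF e) (SF e).
  have := form (r / 2) _ e; rewrite mulrCA divff ?pnatr_eq0 // mulr1; apply.
  by rewrite ger0_norm // divr_ge0 // ltW.
have f2 e : - r * ip (SF e) e <= ip (SF e) (SF e).
  have := form (- (r / 2)) _ e; rewrite mulrN mulrCA divff ?pnatr_eq0 // mulr1; apply.
  by rewrite normrN ger0_norm // divr_ge0 // ltW.
have [C0 C00 near] := near_kernel SS Ssym k0 SK r0 f1 f2.
pose N : R := n.+1%:R; have N0 : 0 < N by rewrite ltr0n.
(* Makes the squared norm of each correction [g i] at most that of [u i] divided by [2 * N]. *)
pose d := (2 * N * C0)^-1.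
have d0 : 0 < d by rewrite invr_gt0 !mulr_gt0.
have [u [u1 u2]] := singular_family n.+1 d0 sx.
have /choice[g gE] : forall i : 'I_n.+1, exists g : fct,
    sq_bounded g ((2 * N)^-1 * ip (u i) (u i)) /\ S (fsval (u i) - g) = 0.
  move=> i; have [ui0 ui1] := u1 i (ltn_ord i).
  have [||g gb gS] := near (u i) (d * ip (u i) (u i)).
  - by rewrite mulr_gt0.
  - by rewrite SFE.
  - exists g; split=> //; apply: sq_bounded_le gb.
    rewrite /d le_eqVlt; apply/orP; left; apply/eqP; field.
    by rewrite !gt_eqF.
pose k i : fct := fsval (u (i : 'I_n.+1)) - g i.
have [i|b [[i0 bi0] bk]] := @real_dependence n k h.
  have : Defs.eigenspace T (rc x) (fun v => rc (k i v)).
    have [gb gS] := gE i; have kb := sq_boundedB (@sq_bounded_fsip R V (u i)) gb.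
    split.
      apply: bounded_l2; apply: csq_boundedD; first exact: kb.
      have -> : imfct (fun v => rc (k i v)) = 0 by [].
      by move=> X; rewrite /sqsum big1 // => v _; rewrite expr0n.
    apply: fct_ext.
      rewrite Tre; have -> : refct (fun v => rc (k i v)) = k i by [].
      move: gS; rewrite -/(k i) SE => /eqP; rewrite subr_eq0 => /eqP ->.
      by apply/funext => v; rewrite /refct !cE mul0r subr0.
    rewrite Tim; have -> : imfct (fun v => rc (k i v)) = 0 by [].
    rewrite linear0; apply/funext => v; rewrite /imfct !cE mulr0 mul0r addr0.
    by [].
  by rewrite hE => -[c cE]; exists c.
have /choice[supp suppE] := @fsfct_supp R V.
pose X := (\bigcup_(i <- enum 'I_n.+1) supp (u i))%fset.
have uX (i : 'I_n.+1) : ip (u i) (u i) = sqsum X (u i).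
  apply: fsip_sqsum => v vX; apply: suppE; apply: contra vX => vi.
  by apply/bigfcupP; exists i; rewrite // mem_enum.
pose Q := \sum_i b i ^+ 2 * ip (u (i : 'I_n.+1)) (u i).
have Q0 : 0 < Q.
  rewrite /Q (bigD1 i0) //= ltr_pwDl //.
    by have [? _] := u1 i0 (ltn_ord i0); rewrite mulr_gt0 // exprn_even_gt0.
  by apply: sumr_ge0 => i _; rewrite mulr_ge0 ?sqr_ge0 ?fsip_ge0.
(* The relation between the [k i] says that the combinations of the [u i] and of the [g i] agree.
   The first is a sum of terms with disjoint supports; the second is estimated by Cauchy-Schwarz,
   with a loss of [N]. *)
have pt v : \sum_i b i ^+ 2 * (u (i : 'I_n.+1) v : R) ^+ 2
    <= N * \sum_i b i ^+ 2 * (g i v : R) ^+ 2.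
  have -> : \sum_i b i ^+ 2 * (u (i : 'I_n.+1) v : R) ^+ 2
      = (\sum_i b i * (u (i : 'I_n.+1) v : R)) ^+ 2.
    rewrite sqr_sum_orthogonal => [|i j ij].
      by apply: eq_bigr => i _; rewrite exprMn.
    by rewrite mulrACA u2 ?ltn_ord // mulr0.
  have -> : \sum_i b i * (u (i : 'I_n.+1) v : R) = \sum_i b i * (g i v : R).
    apply/eqP; rewrite -subr_eq0 -sumrB -[X in _ == X](bk v); apply/eqP.
    by apply: eq_bigr => i _; rewrite -mulrBr.
  have := sqr_sum_le (index_enum 'I_n.+1) (fun i => b i * (g i v : R)).
  rewrite [size _](_ : _ = n.+1); last first.
    by rewrite -sum1_size big_const_ord iter_addn mul1n addn0.
  move=> /le_trans; apply; apply: ler_wpM2l; first exact: ltW.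
  by apply: ler_sum => i _; rewrite exprMn.
(* In the sum of [pt] over [X], the factor [N] meets the [(2 * N)^-1] of the corrections. *)
have : Q <= Q / 2.
  rewrite {1}/Q; under eq_bigr do rewrite uX /sqsum mulr_sumr.
  rewrite exchange_big /=.
  apply: le_trans (ler_sum _ (fun v _ => pt v)) _.
  rewrite -mulr_sumr exchange_big /=.
  have -> : Q / 2 = N * ((2 * N)^-1 * Q) by field; rewrite gt_eqF.
  rewrite ler_pM2l // /Q mulr_sumr; apply: ler_sum => i _.
  rewrite -mulr_sumr mulrCA ler_wpM2l ?sqr_ge0 //.
  by have [gb _] := gE i; exact: gb.
by move: Q0; lra.
Qed.

End EssentialSpectrum.

(** * Schroedinger operators on real functions *)

Section Restriction.
Variables (R : realType) (V : choiceType).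
Local Notation fct := (V -> R^o).
Local Notation fs := (fsfct R V).
Local Notation ip := (@fsip R V).

Lemma restriction_exists (T : {linear fct -> fct}) : local T ->
  (forall f X, supported f X -> exists Y, supported (T f) Y) ->
  exists TF : {linear fs -> fs}, restricts T TF.
Proof.
move=> lT fT.
have /choice[h hE] : forall e : fs, exists e' : fs, fsval e' = T e.
  move=> e; have [X eX] := fsfct_supp e; have [Y TY] := fT _ _ eX.
  by exists (mk_fsfct TY).
have hl : linear h.
  by move=> a e e'; apply: val_inj => /=; rewrite !hE /= linearP.
pose Hh := GRing.isLinear.Build _ _ _ _ h hl.
by exists (HB.pack_for {linear fs -> fs} h Hh); split.
Qed.

Lemma supported_expand (f : fct) (X : {fset V}) : supported f X ->
  f = \sum_(u <- X) f u *: basisf R u.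
Proof.
move=> fX; apply/funext => v; rewrite fct_sumE.
have [vX|vX] := boolP (v \in X); last first.
  rewrite fX // big_seq big1 // => u uX.
  by rewrite fctE /basisf /= eq_sym (negbTE (memPn vX u uX)) scaler0.
rewrite (big_fsetD1 v) //= big_seq big1 ?addr0 => [|u].
  by rewrite fctE /basisf /= eqxx scaler1.
by rewrite !inE fctE /basisf /= eq_sym => /andP[/negbTE -> _]; rewrite scaler0.
Qed.

Lemma kernel_sum (T : {linear fct -> fct}) (f : fct) (X : {fset V}) v :
  supported f X -> (T f v : R) = \sum_(u <- X) (f u : R) * (T (basisf R u) v : R).
Proof.
move=> fX; rewrite {1}(supported_expand fX) linear_sum fct_sumE.
by apply: eq_bigr => u _; rewrite linearZ.
Qed.

Lemma kernel_sym (T : {linear fct -> fct}) (TF : {linear fs -> fs}) :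
  restricts T TF -> (forall u v, T (basisf R u) v = T (basisf R v) u) ->
  ip_sym ip TF.
Proof.
move=> [_ TE] Ts e h.
have [X eX] := fsfct_supp e; have [Y hY] := fsfct_supp h.
rewrite fsipC (fsip_fset _ hY) (fsip_fset _ eX) !TE.
under eq_bigr do rewrite (kernel_sum T _ eX) mulr_sumr.
under [RHS]eq_bigr do rewrite (kernel_sum T _ hY) mulr_sumr.
rewrite exchange_big; apply: eq_bigr => u _; apply: eq_bigr => v _ /=.
by rewrite (Ts u v) mulrCA.
Qed.

End Restriction.

Section GraphDistance.
Variable G : graph.
Implicit Types u v w : G.

Definition nbrs v : set G := [set u | adj u v].

Lemma dist_path u v :
  exists p, [/\ path (@adj G) u p, last u p = v & size p = dist u v].
Proof. by rewrite /dist; case: ex_minnP => n /asboolP. Qed.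

Lemma dist_le u v p : path (@adj G) u p -> last u p = v -> (dist u v <= size p)%N.
Proof.
rewrite /dist => pp pl; case: ex_minnP => n _; apply.
by apply/asboolP; exists p.
Qed.

Lemma dist_sym u v : dist u v = dist v u.
Proof.
suff h w w' : (dist w w' <= dist w' w)%N by apply/eqP; rewrite eqn_leq !h.
have [p [pp pl <-]] := dist_path w' w; rewrite -(size_belast w' p) -size_rev.
apply: dist_le; last by case: p pp pl => //= a p _; rewrite rev_cons last_rcons.
rewrite -pl rev_path; apply: sub_path pp => a b.
by rewrite adj_sym.
Qed.

Lemma dist_triangle u v w : (dist u w <= dist u v + dist v w)%N.
Proof.
have [p [pp pl <-]] := dist_path u v; have [q [qq ql <-]] := dist_path v w.
rewrite -size_cat; apply: dist_le; first by rewrite cat_path pp pl.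
by rewrite last_cat pl.
Qed.

Lemma dist_adj u v : adj u v -> (dist u v <= 1)%N.
Proof. by move=> uv; apply: (@dist_le u v [:: v]) => //=; rewrite uv. Qed.

Lemma gball_adj u w v r : gball v r w -> adj u w -> gball v r.+1 u.
Proof.
rewrite /gball /= => wr uw; apply: leq_trans (dist_triangle u w v) _.
by rewrite -add1n leq_add // dist_adj.
Qed.

Lemma gballS v r : gball v r `<=` gball v r.+1.
Proof. by move=> u; rewrite /gball /= => /leqW. Qed.

End GraphDistance.

Section RealSchrodinger.
Variables (R : realType) (G : graph) (H : schrodinger R G).
Local Notation fct := (G -> R^o).
Local Notation fs := (fsfct R G).
Local Notation ip := (@fsip R G).
Hypothesis nfin : forall v : G, finite_set (nbrs v).

Definition nb (v : G) : {fset G} := fset_set (nbrs v).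

Lemma in_nb u v : (u \in nb v) = adj u v.
Proof. by rewrite in_fset_set //; apply/idP/idP; rewrite inE. Qed.

Definition real_schrodinger (f : fct) : fct := fun v =>
  (\sum_(u <- nb v) ((f u : R) - (f v : R))) + potential H v * (f v : R).

Lemma real_schrodingerE (f : fct) v : real_schrodinger f v =
  \sum_(u <- nb v) ((f u : R) - (f v : R)) + potential H v * (f v : R) :> R.
Proof. by []. Qed.

Lemma real_schrodinger_linear : linear real_schrodinger.
Proof.
move=> a f g; apply/funext => v.
have -> : (a *: real_schrodinger f + real_schrodinger g) v =
  a * (real_schrodinger f v : R) + (real_schrodinger g v : R) by [].
rewrite !real_schrodingerE (mulrDr a) mulr_sumr addrACA -big_split /= !fctZDE.
congr (_ + _); last by ring.
by apply: eq_bigr => u _; rewrite !fctZDE; ring.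
Qed.

Lemma re_schrodinger psi :
  refct (schrodinger_op H psi) = real_schrodinger (refct psi).
Proof.
apply/funext => v; rewrite /refct /schrodinger_op /real_schrodinger.
rewrite fsbig_finite; last exact: nfin.
rewrite !cE cre_sum mul0r subr0; congr (_ + _).
by apply: eq_bigr => u _; rewrite !cE.
Qed.

Lemma im_schrodinger psi :
  imfct (schrodinger_op H psi) = real_schrodinger (imfct psi).
Proof.
apply/funext => v; rewrite /imfct /schrodinger_op /real_schrodinger.
rewrite fsbig_finite; last exact: nfin.
rewrite !cE cim_sum mul0r addr0; congr (_ + _).
by apply: eq_bigr => u _; rewrite !cE.
Qed.

Lemma real_schrodinger_local : local real_schrodinger.
Proof.
move=> v; exists (v |` nb v)%fset => f g fg; rewrite /real_schrodinger.
rewrite (fg v) ?fset1U1 // big_seq [in RHS]big_seq; congr (_ + _).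
by apply: eq_bigr => u uv; rewrite fg // fset1Ur.
Qed.

Lemma real_schrodinger0 (f : fct) v :
  f v = 0 -> (forall u, adj u v -> f u = 0) -> real_schrodinger f v = 0.
Proof.
move=> fv fu; rewrite /real_schrodinger fv mulr0 addr0 big_seq big1 // => u.
by rewrite in_nb => /fu ->; rewrite subr0.
Qed.

Lemma real_schrodinger_supported f X : supported f X ->
  supported (real_schrodinger f) (X `|` \bigcup_(u <- X) nb u)%fset.
Proof.
move=> fX v; rewrite inE negb_or => /andP[vX vN]; apply: real_schrodinger0.
  exact: fX.
move=> u uv; apply: fX; apply: contra vN => uX; apply/bigfcupP; exists u.
  by rewrite uX.
by rewrite in_nb adj_sym.
Qed.

Lemma real_schrodinger_kernel_sym u v :
  real_schrodinger (basisf R u) v = real_schrodinger (basisf R v) u.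
Proof.
have [->//|uv] := eqVneq u v.
have K w w' : w != w' -> real_schrodinger (basisf R w) w' = (adj w w')%:R.
  move=> ww; rewrite /real_schrodinger /basisf (eq_sym w') (negbTE ww) mulr0 addr0.
  under eq_bigr do rewrite subr0.
  have [a|na] := boolP (adj w w').
    rewrite (big_fsetD1 w) ?in_nb //= eqxx big_seq big1 ?addr0 // => x.
    by rewrite !inE => /andP[/negbTE ->].
  rewrite big_seq big1 // => x; rewrite in_nb => xw.
  by case: eqP => // xE; rewrite -xE xw in na.
by rewrite !K // 1?eq_sym // adj_sym.
Qed.

Lemma schrodinger_data : exists (Tr : {linear fct -> fct}) (TF : {linear fs -> fs}),
  [/\ forall f, Tr f = real_schrodinger f, restricts Tr TF & ip_sym ip TF].
Proof.
pose HT := GRing.isLinear.Build _ _ _ _ real_schrodinger real_schrodinger_linear.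
pose Tr := HB.pack_for {linear fct -> fct} real_schrodinger HT.
have [|TF rTF] := @restriction_exists R G Tr real_schrodinger_local.
  by move=> f X fX; eexists; exact: real_schrodinger_supported fX.
exists Tr, TF; split=> //.
by apply: (kernel_sym rTF) => u v; exact: real_schrodinger_kernel_sym.
Qed.

Lemma sum_nb_le (e : fs) (X : {fset G}) (D : nat) :
  (forall v : G, (size (nb v) <= D)%N) ->
  \sum_(v <- X) \sum_(w <- nb v) (e w : R) ^+ 2 <= D%:R * ip e e.
Proof.
move=> degD; have [Y eY] := fsfct_supp e.
have E v : \sum_(w <- nb v) (e w : R) ^+ 2 =
    \sum_(w <- Y) (adj w v)%:R * (e w : R) ^+ 2.
  transitivity (\sum_(w \in [set: G]) (adj w v)%:R * (e w : R) ^+ 2).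
    rewrite (fsbigTE (nb v)) => [|w].
      rewrite big_seq [RHS]big_seq; apply: eq_bigr => w.
      by rewrite in_nb => ->; rewrite mul1r.
    by rewrite in_nb => /negbTE ->; rewrite mul0r.
  by rewrite (fsbigTE Y) // => w /eY ->; rewrite expr0n mulr0.
under eq_bigr do rewrite E.
rewrite exchange_big /= (fsip_sqsum eY) /sqsum mulr_sumr; apply: ler_sum => w _.
rewrite -mulr_suml; apply: ler_wpM2r; first exact: sqr_ge0.
(* After exchanging the sums, each [w] is counted once per neighbour in [X]; this count is a partial
   sum of squares of the indicator of [nb w]. *)
pose f : fct := fun v => (adj w v)%:R.
have fN : supported f (nb w).
  by move=> v; rewrite in_nb adj_sym => /negbTE h; rewrite /f h.
have ff v : (adj w v)%:R = (f v : R) ^+ 2.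
  by rewrite /f; case: adj; rewrite ?expr1n ?expr0n.
under eq_bigr do rewrite ff.
have /= := @sq_bounded_fsip R G (mk_fsfct fN) X.
rewrite (@fsip_sqsum R G (mk_fsfct fN) _ fN) /= => /le_trans; apply.
rewrite /sqsum big_seq.
under eq_bigr => v vN do rewrite -ff adj_sym -in_nb vN.
by rewrite -big_seq big_const_seq count_predT iter_addr_0 ler_nat.
Qed.

Lemma schrodinger_bounded (D : nat) : (forall v : G, (size (nb v) <= D)%N) ->
  exists2 K : R, 0 < K & forall (e : fs) X, sqsum X (real_schrodinger e) <= K * ip e e.
Proof.
move=> degD; have [M QM] := potential_bounded H.
(* The last two groups are the coefficients in [pt], the first with one more factor [D] from
   [sum_nb_le]; the 1 ensures positivity. *)
pose K := 1 + (4 * D%:R * D%:R + (4 * D%:R ^+ 2 + 2 * M ^+ 2)) : R.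
exists K => [|e X].
  have Dn : 0 <= D%:R :> R by rewrite ler0n.
  have := mulr_ge0 Dn Dn; have := sqr_ge0 M.
  by rewrite /K expr2; lra.
have pt v : (real_schrodinger e v : R) ^+ 2 <=
    4 * D%:R * \sum_(w <- nb v) (e w : R) ^+ 2
    + (4 * D%:R ^+ 2 + 2 * M ^+ 2) * (e v : R) ^+ 2.
  rewrite /real_schrodinger.
  have := sqr_sum_le (nb v) (fun u => (e u : R) - (e v : R)).
  have h1 : \sum_(u <- nb v) ((e u : R) - (e v : R)) ^+ 2 <=
     2 * \sum_(u <- nb v) (e u : R) ^+ 2 + 2 * (D%:R * (e v : R) ^+ 2).
    apply: (@le_trans _ _ (\sum_(u <- nb v) (2 * (e u : R) ^+ 2 + 2 * (e v : R) ^+ 2))).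
      apply: ler_sum => u _; have := sqr_ge0 ((e u : R) + (e v : R)).
      by set a : R := e u; set b : R := e v; nra.
    rewrite big_split /= -mulr_sumr lerD2l big_const_seq count_predT iter_addr_0.
    rewrite -[leLHS]mulr_natl mulrCA ler_pM2l //.
    by apply: ler_wpM2r; rewrite ?sqr_ge0 // ler_nat.
  have h2 : (size (nb v))%:R * \sum_(u <- nb v) ((e u : R) - (e v : R)) ^+ 2 <=
     D%:R * (2 * \sum_(u <- nb v) (e u : R) ^+ 2 + 2 * (D%:R * (e v : R) ^+ 2)).
    apply: ler_pM => //; last by rewrite ler_nat.
    by apply: sumr_ge0 => u _; exact: sqr_ge0.
  have q2 : potential H v ^+ 2 <= M ^+ 2.
    rewrite -(real_normK (num_real _)) ler_sqr ?nnegrE // ?(le_trans _ (QM v)) //.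
  have := ler_wpM2r (sqr_ge0 (e v : R)) q2.
  move: h2; set a := \sum_(u <- _) (_ - _); set b := (size _)%:R * _.
  set c := \sum_(u <- _) _; set x : R := e v; set q := potential H v.
  move: D%:R => d h2 h3 h4.
  have := sqr_ge0 (a - q * x); nra.
apply: le_trans (ler_sum _ (fun v _ => pt v)) _.
rewrite big_split /= -!mulr_sumr.
have s1 := sum_nb_le e X degD; have s2 := @sq_bounded_fsip R G e X.
rewrite /K mulrDl mul1r mulrDl.
have D0 : 0 <= 4 * D%:R :> R by rewrite mulr_ge0.
have := ler_wpM2l D0 s1.
have c0 : 0 <= 4 * D%:R ^+ 2 + 2 * M ^+ 2.
  by have := sqr_ge0 (D%:R : R); have := sqr_ge0 M; lra.
have := ler_wpM2l c0 s2; have := fsip_ge0 e; rewrite /sqsum !mulrA; lra.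
Qed.

End RealSchrodinger.

(** * Transport along R-limits *)

Section Transport.
Variable R : realType.

(** Vectors live in radius [r] and the operator reaches one step further, hence the two radii. The
    graph structure inside the balls enters only through matrix entries of the operator. *)
Record ball_map (G G' : graph) (r : nat) (w : G) (w' : G') (phi : G' -> G) : Prop :=
  BallMap {
    ball_map_inj : {in gball w' r.+1 &, injective phi};
    ball_map_sub : forall x, gball w' r x -> gball w r (phi x);
    ball_map_surj : forall y, gball w r.+1 y ->
      exists2 x, gball w' r.+1 x & phi x = y }.

(** With [phi := id], the formula for the shifted norm also covers the limit graph, so both sides of
    the limit have the same shape. *)
Lemma ball_map_id (G : graph) r (w : G) : ball_map r w w id.
Proof. by split=> // y wy; exists y. Qed.

Section Formula.
Variables (G G' : graph) (H : schrodinger R G) (r : nat) (w : G) (w' : G').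
Hypothesis nfin : forall v : G, finite_set (nbrs v).
Hypothesis bfin : finite_set (gball w' r.+1).
Variables (Tr : {linear (G -> R^o) -> (G -> R^o)}).
Variables (TF : {linear fsfct R G -> fsfct R G}).
Hypotheses (TrE : forall f, Tr f = real_schrodinger H f) (TTF : restricts Tr TF).
Variables (phi : G' -> G) (e : fsfct R G').
Hypotheses (phiP : ball_map r w w' phi) (er : forall x, e x != 0 -> gball w' r x).
Let B := fset_set (gball w' r.+1).

Lemma in_ball x : x \in B <-> gball w' r.+1 x.
Proof. by rewrite in_fset_set //; split; rewrite inE. Qed.

Lemma phi_inj : {in B &, injective phi}.
Proof.
by move=> x y /in_ball xB /in_ball yB; apply: (ball_map_inj phiP); rewrite inE.
Qed.

Lemma pushforward_exists : exists u : fsfct R G,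
  (forall x, x \in B -> u (phi x) = e x) /\ (forall y, u y != 0 -> gball w r y).
Proof.
pose f : G -> R^o := fun y => \sum_(x <- B) (e x : R) * (y == phi x)%:R.
have fS : supported f [fset phi x | x in B]%fset.
  move=> y yB; rewrite /f big_seq big1 // => x xB.
  case: eqP => [E|_]; last by rewrite mulr0.
  by move: yB; rewrite E in_imfset.
exists (mk_fsfct fS); split=> [x xB|y].
  rewrite /= /f (big_fsetD1 x) //= eqxx mulr1 big_seq big1 ?addr0 // => z.
  rewrite !inE => /andP[zx zB]; case: eqP => [E|_]; last by rewrite mulr0.
  by rewrite (phi_inj xB zB E) eqxx in zx.
rewrite /= => fy; apply: contrapT => ny; move: fy => /eqP; apply.
rewrite /f big1 // => x _.
have [->|ex] := eqVneq (e x) 0; first by rewrite mul0r.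
case: eqP => [E|_]; last by rewrite mulr0.
by case: ny; rewrite E; apply: (ball_map_sub phiP); exact: er.
Qed.

Variable u : fsfct R G.
Hypotheses (uphi : forall x, x \in B -> u (phi x) = e x)
  (ur : forall y, u y != 0 -> gball w r y).

Lemma in_image y : gball w r.+1 y -> y \in [fset phi x | x in B]%fset.
Proof.
by move=> /(ball_map_surj phiP)[x /in_ball xB <-]; rewrite in_imfset.
Qed.

Lemma pushforward_supported : supported u [fset phi x | x in B]%fset.
Proof.
move=> y yB; apply/eqP; apply: contraNT yB => /ur h.
by apply: in_image; exact: gballS.
Qed.

Lemma pushforward_sum (F : G -> R) :
  \sum_(y <- [fset phi x | x in B]%fset) F y = \sum_(x <- B) F (phi x).
Proof. by rewrite big_imfset //; exact: phi_inj. Qed.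

Lemma pushforward_norm : fsip u u = fsip e e.
Proof.
rewrite (fsip_sqsum pushforward_supported) /sqsum pushforward_sum.
have eB : supported e B.
  move=> x xB; apply/eqP; apply: contraNT xB => /er h.
  by apply/in_ball; exact: gballS.
rewrite (fsip_sqsum eB) /sqsum big_seq [RHS]big_seq; apply: eq_bigr => x xB.
by rewrite uphi.
Qed.

(** Reduces the norm to finitely many matrix entries of the operator, whose convergence an R-limit
    provides. *)
Lemma pushforward_shift_norm (z : R) :
  fsip (TF u - z *: u) (TF u - z *: u) = \sum_(y <- B)
    (\sum_(x <- B) (e x : R) * (real_schrodinger H (basisf R (phi x)) (phi y) : R)
      - z * (e y : R)) ^+ 2.
Proof.
pose S : fsfct R G := TF u - z *: u.
have SE y : (S y : R) = (Tr u y : R) - z * (u y : R).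
  by rewrite -TTF.2.
have SS : supported S [fset phi x | x in B]%fset.
  move=> y yB; rewrite [LHS]SE (pushforward_supported yB) mulr0 subr0 TrE.
  apply: (real_schrodinger0 H nfin); first exact: pushforward_supported yB.
  move=> q qy; apply/eqP; apply: contraNT yB => /ur h.
  by apply: in_image; apply: gball_adj h _; rewrite adj_sym.
rewrite -/S (fsip_sqsum SS) /sqsum pushforward_sum.
rewrite big_seq [RHS]big_seq; apply: eq_bigr => y yB; congr (_ ^+ 2).
rewrite SE uphi // (kernel_sum Tr _ pushforward_supported) pushforward_sum.
congr (_ - _); rewrite big_seq [RHS]big_seq; apply: eq_bigr => x xB.
by rewrite uphi // TrE.
Qed.

End Formula.

Lemma cvg_cre (F : nat -> cplx R) (z : cplx R) :
  F @ \oo --> z -> (fun n => cre (F n)) @ \oo --> cre z.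
Proof.
move=> Fz; apply/(@cvgrPdist_lt _ R^o) => d d0.
have d0' : 0 < rc d by rewrite (@ltcE R) /= eqxx.
move/cvgrPdist_lt/(_ _ d0') : Fz; apply: filterS => n h.
have := le_lt_trans (@normc_ge_Re R (z - F n)) h.
by rewrite (@ltcE R) => /andP[_] /=; rewrite -/(cre _) creD creN.
Qed.

Lemma conform_mxE (A : Type) (n m : nat) (B : 'M[A]_m) (M : 'M[A]_n) (nm : n = m)
  (i j : 'I_m) : conform_mx B M i j = M (cast_ord (esym nm) i) (cast_ord (esym nm) j).
Proof. by case: _ / nm B i j => B i j; rewrite conform_mx_id !cast_ord_id. Qed.

Lemma refct_delta (V : choiceType) (u : V) : refct (delta R u) = basisf R u.
Proof. by apply/funext => v; rewrite /refct /delta /basisf; case: eqP. Qed.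

Section Labels.
Variables (G : graph) (v : G) (eta : nat -> G -> nat).
Hypothesis cv : coherent v eta.
Variable r : nat.
Hypothesis r0 : (0 < r)%N.

Definition label_inv : nat -> G := 'pinv_(fun=> v) (gball v r) (eta r).

Lemma coherent_finite : finite_set (gball v r).
Proof.
have [/(_ r r0) h _] := cv.
rewrite (eq_finite_set (B := `I_(gball_card v r))) //.
by apply/card_set_bijP; exists (eta r).
Qed.

Lemma label_lt x : gball v r x -> (eta r x < gball_card v r)%N.
Proof. by have [/(_ r r0)[h _ _] _] := cv => /h. Qed.

Lemma labelK x : gball v r x -> label_inv (eta r x) = x.
Proof.
have [/(_ r r0)[_ h _] _] := cv => xB.
by apply: pinvKV => //; rewrite inE.
Qed.

Lemma label_surj a : (a < gball_card v r)%N -> exists2 x, gball v r x & eta r x = a.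
Proof. by have [/(_ r r0)[_ _ h] _] := cv => /h. Qed.

End Labels.

(** Vertices with equal labels at radius [r.+1] are matched; by coherence these labels extend those
    at radius [r], so the smaller balls are matched too. *)
Lemma label_ball_map (G G' : graph) (v : G) (v' : G') eta eta' r :
  coherent v eta -> coherent v' eta' -> (0 < r)%N ->
  gball_card v r = gball_card v' r -> gball_card v r.+1 = gball_card v' r.+1 ->
  ball_map r v v' (fun x => label_inv v eta r.+1 (eta' r.+1 x)).
Proof.
move=> cv cv' r0 N1 N2; have r1 : (0 < r.+1)%N by [].
split.
- move=> x y; rewrite !inE => xB yB.
  have [a aB aE] : exists2 a, gball v r.+1 a & eta r.+1 a = eta' r.+1 x.
    by apply: label_surj => //; rewrite N2; exact: label_lt.
  have [b bB bE] : exists2 b, gball v r.+1 b & eta r.+1 b = eta' r.+1 y.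
    by apply: label_surj => //; rewrite N2; exact: label_lt.
  rewrite -aE -bE !labelK // => ab.
  by rewrite -(labelK cv' r1 xB) -(labelK cv' r1 yB) -aE -bE ab.
- move=> x xB.
  have [a aB aE] : exists2 a, gball v r a & eta r a = eta' r x.
    by apply: label_surj => //; rewrite N1; exact: label_lt.
  rewrite (cv'.2 r r.+1 r0 (ltnSn r) x xB) -aE -(cv.2 r r.+1 r0 (ltnSn r) a aB).
  by rewrite labelK //; exact: gballS.
- move=> y yB.
  have [x xB xE] : exists2 x, gball v' r.+1 x & eta' r.+1 x = eta r.+1 y.
    by apply: label_surj => //; rewrite -N2; exact: label_lt.
  by exists x => //; rewrite xE labelK.
Qed.

Lemma R_limit_ball_maps (G G' : graph) (H : schrodinger R G) (H' : schrodinger R G')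
  (v : nat -> G) (v0' : G') : (forall u : G, finite_set (nbrs u)) ->
  (forall u : G', finite_set (nbrs u)) ->
  R_limit_along H v H' v0' -> exists2 n : nat -> nat, {homo n : i j / (i < j)%N} &
  forall r, (0 < r)%N -> exists phi : nat -> G' -> G,
    (\forall j \near \oo, ball_map r (v (n j)) v0' (phi j)) /\
    forall x y, gball v0' r.+1 x -> gball v0' r.+1 y ->
      (fun j => real_schrodinger H (basisf R (phi j x)) (phi j y) : R) @ \oo -->
      (real_schrodinger H' (basisf R x) y : R).
Proof.
move=> nfin nfin' [n [ninc [eta [eta' [ce ce' lim]]]]]; exists n => // r r0.
exists (fun j x => label_inv (v (n j)) (eta j) r.+1 (eta' r.+1 x)).
have [N1 _] := lim r r0; have [N2 cM] := lim r.+1 isT.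
split.
  by near=> j; apply: label_ball_map => //; near: j.
move=> x y xB yB.
pose a := Ordinal (label_lt ce' (ltn0Sn r) xB).
pose b := Ordinal (label_lt ce' (ltn0Sn r) yB).
have := cvg_comp _ _ cM (@coord_continuous _ _ _ b a _) => /cvg_cre.
rewrite [X in _ --> X](_ : _ = (real_schrodinger H' (basisf R x) y : R)); last first.
  rewrite mxE -/(label_inv _ _ _) /= !labelK //.
  rewrite -[cre _]/(refct _ _) re_schrodinger // refct_delta.
  by [].
apply: cvg_trans; apply: near_eq_cvg; near=> j => /=.
have N2j : gball_card (v (n j)) r.+1 = gball_card v0' r.+1 by near: j.
rewrite (conform_mxE _ _ N2j) mxE /= -[cre _]/(refct _ _) re_schrodinger // refct_delta.
by [].
Unshelve. all: by end_near. Qed.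

(** If the ball met [X], the triangle inequality would keep [v (n j)] within [M + r] of the start of
    the path. *)
Lemma path_leaves_finite (G : graph) (v : nat -> G) (n : nat -> nat) (X : {fset G}) r :
  path_to_infinity v -> {homo n : i j / (i < j)%N} ->
  \forall j \near \oo, forall y, y \in X -> ~ gball (v (n j)) r y.
Proof.
move=> [_ _ dv] ninc.
have nj j : (j <= n j)%N by elim: j => // j IH; apply: leq_ltn_trans IH (ninc _ _ _).
pose M := (\max_(x <- X) dist x (v 0%N))%N.
have [j0 _ hj0] : \forall j \near \oo, (M + r < dist (v j) (v 0%N))%N.
  exact: (dv _ (nbhs_infty_gt (M + r))).
exists j0 => // j /= jj y yX yb.
have := hj0 (n j) (leq_trans jj (nj j)); rewrite /= ltnNge => /negP; apply.
apply: leq_trans (dist_triangle (v (n j)) y (v 0%N)) _.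
rewrite addnC leq_add //; last by rewrite dist_sym.
exact: (@leq_bigmax_seq _ (enum_fset X) xpredT (fun x : G => dist x (v 0%N)) y yX isT).
Qed.

End Transport.

Lemma supported_in_ball (R : realType) (G : graph) (e : fsfct R G) (w : G) :
  exists2 r, (0 < r)%N & forall x, e x != 0 -> gball w r x.
Proof.
have [X eX] := fsfct_supp e; exists (\max_(x <- X) dist x w).+1 => // x ex.
apply: gballS; rewrite /gball /=.
apply: (@leq_bigmax_seq _ (enum_fset X) xpredT (fun x : G => dist x w) x _ isT).
by apply: contraNT ex => /eX ->.
Qed.

(** [F] is chosen before [X]: the finite set affects only the rank from which the copies avoid
    it. *)
Lemma transport (R : realType) (G G' : graph) (H : schrodinger R G)
  (H' : schrodinger R G') (v : nat -> G) (v0' : G')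
  (Tr : {linear (G -> R^o) -> (G -> R^o)}) (TF : {linear fsfct R G -> fsfct R G})
  (Tr' : {linear (G' -> R^o) -> (G' -> R^o)})
  (TF' : {linear fsfct R G' -> fsfct R G'}) :
  (forall u : G, finite_set (nbrs u)) -> (forall u : G', finite_set (nbrs u)) ->
  (forall r, (0 < r)%N -> finite_set (gball v0' r)) ->
  (forall f, Tr f = real_schrodinger H f) -> restricts Tr TF ->
  (forall f, Tr' f = real_schrodinger H' f) -> restricts Tr' TF' ->
  path_to_infinity v -> R_limit_along H v H' v0' ->
  forall (e : fsfct R G') (z : R), exists2 F : nat -> R,
    F @ \oo --> fsip (TF' e - z *: e) (TF' e - z *: e) &
    forall X : {fset G}, \forall j \near \oo, exists u : fsfct R G,
      [/\ fsip u u = fsip e e, fsip (TF u - z *: u) (TF u - z *: u) = F j &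
          forall y, y \in X -> u y = 0].
Proof.
move=> nfin nfin' bfin TrE rT TrE' rT' pv lim e z.
have [n ninc maps] := R_limit_ball_maps nfin nfin' lim.
have [r r0 er] := supported_in_ball e v0'.
have [phi [phiP phiK]] := maps r r0.
have br := bfin r.+1 (ltn0Sn r).
pose B := fset_set (gball v0' r.+1).
exists (fun j => \sum_(y <- B) (\sum_(x <- B) (e x : R) *
  (real_schrodinger H (basisf R (phi j x)) (phi j y) : R) - z * (e y : R)) ^+ 2).
  rewrite (pushforward_shift_norm nfin' br TrE' rT' (ball_map_id r v0')
    (u := e) (fun x _ => erefl) er).
  apply: cvg_sumr => y yB; rewrite expr2; under eq_fun do rewrite expr2.
  have c : (fun j => \sum_(x <- B) (e x : R) *
     (real_schrodinger H (basisf R (phi j x)) (phi j y) : R) - z * (e y : R)) @ \oo -->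
     \sum_(x <- B) (e x : R) * (real_schrodinger H' (basisf R x) y : R) - z * (e y : R).
    apply: (@cvgB _ R^o); last exact: cvg_cst.
    apply: cvg_sumr => x xB; apply: (@cvgM R); first exact: cvg_cst.
    by apply: phiK; apply/(in_ball br).
  exact: cvgM.
move=> X; have := path_leaves_finite X r pv ninc.
move: phiP; apply: filterS2 => j phij leave.
have [u [uphi ur]] := pushforward_exists br phij er.
exists u; split.
- exact: (pushforward_norm br phij er uphi ur).
- exact: (pushforward_shift_norm nfin br TrE rT phij uphi ur).
- by move=> y yX; apply: contrapT => /eqP/ur; exact: leave.
Qed.

Lemma R_limit_singular (R : realType) (G G' : graph) (H : schrodinger R G)
  (H' : schrodinger R G') (v0' : G') (z : cplx R) :
  bounded_degree G -> R_limit H H' v0' -> spectrum (schrodinger_op H') z ->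
  ess_spectrum (schrodinger_op H) z.
Proof.
move=> [D degG] [v [pv lim]] sz.
have nfin (u : G) : finite_set (nbrs u).
  by apply: (card_le_finite (degG u)); exact: finite_II.
have bfin r : (0 < r)%N -> finite_set (gball v0' r).
  by have [n [_ [eta [eta' [_ ce' _]]]]] := lim; exact: coherent_finite ce' _.
(* Neighbours of [u] lie in a ball around [v0'], which is finite by coherence of its labels. *)
have nfin' (u : G') : finite_set (nbrs u).
  apply: sub_finite_set (bfin (dist u v0').+1 isT) => w wu.
  by apply: gball_adj wu; rewrite /gball /=.
have [Tr [TF [TrE rT Tsym]]] := schrodinger_data H nfin.
have [Tr' [TF' [TrE' rT' Tsym']]] := schrodinger_data H' nfin'.
have [|K K0 bd] := @schrodinger_bounded R G H nfin D.
  by move=> u; have := geq_card_fset_set (degG u); exact.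
have TK e : fsip (TF e) (TF e) <= K * fsip e e.
  have [X eX] := fsfct_supp (TF e).
  by rewrite (fsip_sqsum eX) rT.2 TrE; exact: bd.
have tr := transport nfin nfin' bfin TrE rT TrE' rT' pv lim.
(* The bound for [H] holds for each transported copy of [e]; with [z = 0] it passes to the limit. *)
have TK' e : fsip (TF' e) (TF' e) <= K * fsip e e.
  have [F cF near] := tr e 0; rewrite scale0r subr0 in cF.
  apply: (cvgr_to_le cF); move: (near fset0); apply: filterS => j [u [u1 u2 _]].
  by rewrite -u2 scale0r subr0 -u1.
have Tre psi : refct (schrodinger_op H psi) = Tr (refct psi).
  by rewrite TrE re_schrodinger.
have Tim psi : imfct (schrodinger_op H psi) = Tr (imfct psi).
  by rewrite TrE im_schrodinger.
have Tre' psi : refct (schrodinger_op H' psi) = Tr' (refct psi).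
  by rewrite TrE' re_schrodinger.
have Tim' psi : imfct (schrodinger_op H' psi) = Tr' (imfct psi).
  by rewrite TrE' im_schrodinger.
have [-> nb'] := spectrum_real Tre' Tim' rT' Tsym' K0 TK' sz.
apply: (singular_ess_spectrum Tre Tim rT Tsym K0 TK) => d X d0.
have [e ed] := not_bounded_below_small nb' d0.
have e0 : 0 < fsip e e.
  by rewrite -(pmulr_rgt0 _ d0); apply: le_lt_trans ed; exact: fsip_ge0.
have [F cF near] := tr e (cre z).
(* The strict inequality [ed] for the limit holds for [F j] at all large indices. *)
have nF : \forall j \near \oo, F j < d * fsip e e by exact: (cvgr_lt _ cF).
have [j _ /(_ j (leqnn j))[[u [u1 u2 u3]] Fj]] := filterI (near X) nF.
exists u; split=> //; first by rewrite u1.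
by rewrite u2 u1 ltW.
Qed.

Local Close Scope ring_scope.

Theorem theorem1p2 (R : realType) (G : graph) (hG : bounded_degree G)
    (H : schrodinger R G) :
  [set z : cplx R | exists (G' : graph) (H' : schrodinger R G') (v0' : G'),
     R_limit H H' v0' /\ spectrum (schrodinger_op H') z]
  `<=` ess_spectrum (schrodinger_op H).
Proof. by move=> z [G' [H' [v0' [lim sz]]]]; exact: R_limit_singular hG lim sz. Qed.
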